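(* (1) The map $\lambda\mapsto L(\lambda)$ induces a bijection between $X^+(\infty)$ and the set of isomorphism classes of irreducible $\mathbf U(\infty)$-modules in the category $\mathcal C^{int}\cap\mathcal C^{hi}$. (2) The map $\lambda\mapsto L(\lambda)$ induces a bijection between $X^+(\infty)$ and the set of isomorphism classes of irreducible $\mathbf U(\infty)$-modules in the category $\mathcal C^{int}\cap\mathcal O$.
   Context: $v$ indeterminate. $\mathbf U(\infty)$ is the $\mathbb Q(v)$-algebra with generators $E_i,F_i,K_i,K_i^{-1}$ ($i\in\mathbb Z$) and relations: $K_iK_j=K_jK_i$, $K_iK_i^{-1}=1$; $K_iE_j=v^{\delta_{i,j}-\delta_{i,j+1}}E_jK_i$; $K_iF_j=v^{\delta_{i,j+1}-\delta_{i,j}}F_jK_i$; $E_iE_j=E_jE_i$, $F_iF_j=F_jF_i$ if $|i-j|>1$; $E_iF_j-F_jE_i=\delta_{i,j}\frac{\widetilde K_i-\widetilde K_i^{-1}}{v-v^{-1}}$, $\widetilde K_i=K_iK_{i+1}^{-1}$; $E_i^2E_j-(v+v^{-1})E_iE_jE_i+E_jE_i^2=0$ and likewise for $F$ if $|i-j|=1$. $X(\infty)$ is the set of all integer sequences $\lambda=(\lambda_i)_{i\in\mathbb Z}$; $X^+(\infty)=\{\lambda\in X(\infty):\lambda_i\ge\lambda_{i+1}\ \forall i\}$. $\alpha_i=\varepsilon_i-\varepsilon_{i+1}$; $\mu\le_{wt}\lambda$ iff $\lambda-\mu$ is a finite $\mathbb N$-combination of the $\alpha_i$; $(-\infty,\lambda]=\{\mu:\mu\le_{wt}\lambda\}$.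 For a $\mathbf U(\infty)$-module $M$, $M_\lambda=\{x:K_ix=v^{\lambda_i}x\ \forall i\}$, $\mathrm{wt}(M)=\{\lambda:M_\lambda\ne0\}$; weight module: $M=\bigoplus_\lambda M_\lambda$. $\mathcal C^{int}$: weight modules such that for all $x\in M$, $i\in\mathbb Z$ there is $n_0$ with $E_i^nx=F_i^nx=0$ for all $n\ge n_0$. $\mathcal C^{hi}$: weight modules such that for each $x$ there is $n_0$ with $ux=0$ for all monomials $u$ in the $E_i$'s with at least $n_0$ factors. $\mathcal O$: weight modules with finite-dimensional weight spaces such that $\mathrm{wt}(M)\subseteq\bigcup_{k=1}^s(-\infty,\lambda^{(k)}]$ for some finitely many $\lambda^{(k)}\in X(\infty)$. The Verma module $M(\lambda)=\mathbf U(\infty)/(\sum_i\mathbf U(\infty)E_i+\sum_i\mathbf U(\infty)(K_i-v^{\lambda_i}))$ has a unique maximal submodule; $L(\lambda)$ is its irreducible quotient. All categories are full subcategories of $\mathbf U(\infty)$-modules. *)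

(* Defs.v *)
From HB Require Import structures.
From mathcomp Require Import all_boot all_order all_algebra fraction.
Set Implicit Arguments. Unset Strict Implicit. Unset Printing Implicit Defensive.
Import Order.TTheory GRing.Theory Num.Theory.
Local Open Scope ring_scope.

Definition Qv : fieldType := {fraction {poly rat}}.
Definition v : Qv := FracField.tofrac ('X : {poly rat}).

(* A U(infinity)-module structure on a Q(v)-vector space M is given by the
   action of the generators E_i, F_i, K_i, K_i^{-1} (i in Z) as Q(v)-linear
   maps satisfying the defining relations of U(infinity). *)
Record Uaction (M : lmodType Qv) := {
  uE : int -> M -> M;
  uF : int -> M -> M;
  uK : int -> M -> M;
  uKi : int -> M -> M;
  uE_lin : forall i (a : Qv) (x y : M), uE i (a *: x + y) = a *: uE i x + uE i y;
  uF_lin : forall i (a : Qv) (x y : M), uF i (a *: x + y) = a *: uF i x + uF i y;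
  uK_lin : forall i (a : Qv) (x y : M), uK i (a *: x + y) = a *: uK i x + uK i y;
  uKi_lin : forall i (a : Qv) (x y : M), uKi i (a *: x + y) = a *: uKi i x + uKi i y;
  uKK : forall i j x, uK i (uK j x) = uK j (uK i x);
  uKKi : forall i x, uK i (uKi i x) = x;
  uKiK : forall i x, uKi i (uK i x) = x;
  uKE : forall i j x,
    uK i (uE j x) = v ^ ((i == j)%:Z - (i == j + 1)%:Z) *: uE j (uK i x);
  uKF : forall i j x,
    uK i (uF j x) = v ^ ((i == j + 1)%:Z - (i == j)%:Z) *: uF j (uK i x);
  uEE : forall i j x, (1 < `|i - j|)%R -> uE i (uE j x) = uE j (uE i x);
  uFF : forall i j x, (1 < `|i - j|)%R -> uF i (uF j x) = uF j (uF i x);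
  uEF : forall i j x,
    uE i (uF j x) - uF j (uE i x) =
    (i == j)%:R *: ((v - v^-1)^-1 *: (uK i (uKi (i + 1) x) - uK (i + 1) (uKi i x)));
  uSerreE : forall i j x, `|i - j| = 1 ->
    uE i (uE i (uE j x)) - (v + v^-1) *: uE i (uE j (uE i x)) + uE j (uE i (uE i x)) = 0;
  uSerreF : forall i j x, `|i - j| = 1 ->
    uF i (uF i (uF j x)) - (v + v^-1) *: uF i (uF j (uF i x)) + uF j (uF i (uF i x)) = 0
}.

(* list membership (Prop-valued; for types without decidable equality) *)
Fixpoint inL (T : Type) (x : T) (s : seq T) : Prop :=
  if s is y :: s' then y = x \/ inL x s' else False.

Definition weight := int -> int.

Definition dominant (la : weight) : Prop := forall i, la (i + 1) <= la i.

Definition alpha (i : int) : weight := fun j => (j == i)%:Z - (j == i + 1)%:Z.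

(* mu <=_wt la iff la - mu is a finite N-combination of the alpha_i
   (the list s records the alpha_i's with multiplicity). *)
Definition le_wt (mu la : weight) : Prop :=
  exists s : seq int, forall j, la j - mu j = \sum_(i <- s) alpha i j.

Section Modules.
Variables (M : lmodType Qv) (a : Uaction M).

Definition in_wspace (la : weight) (x : M) : Prop :=
  forall i, uK a i x = v ^ (la i) *: x.

Definition is_weight (la : weight) : Prop :=
  exists2 x : M, x != 0 & in_wspace la x.

(* weight module: M is the sum (automatically direct) of its weight spaces *)
Definition weight_module : Prop :=
  forall x : M, exists s : seq (weight * M),
    (forall p, inL p s -> in_wspace p.1 p.2) /\ x = \sum_(p <- s) p.2.

Definition in_Cint : Prop :=
  weight_module /\
  forall (x : M) (i : int), exists n0 : nat, forall n : nat, (n0 <= n)%N ->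
    iter n (uE a i) x = 0 /\ iter n (uF a i) x = 0.

Definition in_Chi : Prop :=
  weight_module /\
  forall x : M, exists n0 : nat, forall w : seq int, (n0 <= size w)%N ->
    foldr (fun i y => uE a i y) x w = 0.

Definition fin_dim_wspace (la : weight) : Prop :=
  exists s : seq M, (forall y, y \in s -> in_wspace la y) /\
    forall x, in_wspace la x -> exists c : 'I_(size s) -> Qv,
      x = \sum_(k < size s) c k *: s`_k.

Definition in_O : Prop :=
  weight_module /\ (forall la, fin_dim_wspace la) /\
  exists ls : seq weight, forall mu, is_weight mu ->
    exists2 la, inL la ls & le_wt mu la.

Definition submodule (P : M -> Prop) : Prop :=
  P 0 /\ (forall x y, P x -> P y -> P (x + y)) /\
  (forall (c : Qv) x, P x -> P (c *: x)) /\
  (forall i x, P x ->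
     P (uE a i x) /\ P (uF a i x) /\ P (uK a i x) /\ P (uKi a i x)).

Definition irreducible : Prop :=
  (exists x : M, x != 0) /\
  forall P, submodule P -> (forall x, P x -> x = 0) \/ (forall x, P x).

Definition maximal_submodule (P : M -> Prop) : Prop :=
  submodule P /\ (exists x, ~ P x) /\
  forall Q, submodule Q -> (forall x, P x -> Q x) ->
    (forall x, Q x -> P x) \/ (forall x, Q x).

End Modules.

Definition is_hom (N M : lmodType Qv) (b : Uaction N) (a : Uaction M)
    (f : N -> M) : Prop :=
  (forall (c : Qv) x y, f (c *: x + y) = c *: f x + f y) /\
  forall i x, f (uE b i x) = uE a i (f x) /\ f (uF b i x) = uF a i (f x) /\
              f (uK b i x) = uK a i (f x) /\ f (uKi b i x) = uKi a i (f x).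

(* (V, m) is the Verma module M(la) = U / (sum_i U E_i + sum_i U (K_i - v^la_i))
   with m the image of 1, described by its defining universal property:
   module maps M(la) -> N correspond to vectors n of N with E_i n = 0 and
   K_i n = v^(la_i) n. *)
Definition is_verma (V : lmodType Qv) (b : Uaction V) (la : weight) (m : V) : Prop :=
  in_wspace b la m /\ (forall i, uE b i m = 0) /\
  forall (N : lmodType Qv) (c : Uaction N) (n : N),
    in_wspace c la n -> (forall i, uE c i n = 0) ->
    exists f : V -> N, [/\ is_hom b c f, f m = n &
      forall g : V -> N, is_hom b c g -> g m = n -> forall x, g x = f x].

(* M is isomorphic to L(la), the quotient of M(la) by its (unique) maximal
   submodule: there is a surjective module map M(la) -> M whose kernel is a
   maximal submodule. *)
Definition iso_L (M : lmodType Qv) (a : Uaction M) (la : weight) : Prop :=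
  exists (V : lmodType Qv) (b : Uaction V) (m : V), is_verma b la m /\
    exists f : V -> M, [/\ is_hom b a f, (forall y, exists x, f x = y) &
      maximal_submodule b (fun x => f x = 0)].

(* la |-> [L(la)] is a bijection from X^+(infinity) onto the isomorphism
   classes of irreducible modules in the (iso-closed) category C. *)
Definition L_bijection (C : forall M : lmodType Qv, Uaction M -> Prop) : Prop :=
  (forall la, dominant la ->
     exists (M : lmodType Qv) (a : Uaction M), [/\ C M a, irreducible a & iso_L a la]) /\
  (forall la mu (M : lmodType Qv) (a : Uaction M), dominant la -> dominant mu ->
     iso_L a la -> iso_L a mu -> la = mu) /\
  (forall (M : lmodType Qv) (a : Uaction M), C M a -> irreducible a ->
     exists la, dominant la /\ iso_L a la).

(* Main.v *)
Require Import Defs.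
From HB Require Import structures.
From mathcomp Require Import all_boot all_order all_algebra fraction.
From mathcomp Require Import generic_quotient boolp functions.
From mathcomp Require Import ring zify.

(** Let W be the space of functions phi from words in Z to Q(v), where phi(w)
    stands for the coefficient, on a highest weight vector of weight la, of E_w
    applied to a vector.  This reading forces the action of all generators on W,
    and every relation holds there except the commutation and Serre relations
    among the E's; for those among the F's this is because they commute with the
    E's and vanish at the empty word.  By the Chevalley twist the E-relations
    commute with the F's, hence hold on the orbit of the indicator of the empty
    word.  That orbit is L(la): a vector killed by all the E's is a multiple of the
    indicator, so every nonzero submodule contains it; for la dominant,
    F_i^(la_i - la_(i+1) + 1) sends the indicator to a vector killed by the E's and
    vanishing at the empty word, and local nilpotence of F_i follows by Serre.
    Conversely, an irreducible module in either category contains a vector killed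
    by the E's, whose weight is dominant by the sl_2 formula for E_i F_i^n.  The
    weight is unique because all weights of a module generated by a highest weight
    vector lie below that vector's weight. *)

Set Implicit Arguments. Unset Strict Implicit. Unset Printing Implicit Defensive.
Import Order.TTheory GRing.Theory Num.Theory.
Local Open Scope ring_scope.
Local Open Scope quotient_scope.

(** * Actions without commutation and Serre relations *)

Section LinearMaps.
Variables (R : pzRingType) (M N : lmodType R) (f : M -> N).
Hypothesis f_lin : forall (a : R) x y, f (a *: x + y) = a *: f x + f y.

Lemma linD x y : f (x + y) = f x + f y.
Proof. by have := f_lin 1 x y; rewrite !scale1r. Qed.

Lemma lin0 : f 0 = 0.
Proof. by apply: (addrI (f 0)); rewrite -linD !addr0. Qed.

Lemma linZ a x : f (a *: x) = a *: f x.
Proof. by have := f_lin a x 0; rewrite lin0 !addr0. Qed.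

Lemma linN x : f (- x) = - f x.
Proof. by rewrite -scaleN1r linZ scaleN1r. Qed.

Lemma linB x y : f (x - y) = f x - f y.
Proof. by rewrite linD linN. Qed.

Lemma lin_sum I (r : seq I) (G : I -> M) :
  f (\sum_(i <- r) G i) = \sum_(i <- r) f (G i).
Proof. by elim: r => [|i r IH]; rewrite ?big_nil ?lin0 // !big_cons linD IH. Qed.

End LinearMaps.

(** The Cartan matrix of type $A_\infty$: $\widetilde K_i$ moves past $F_j$ at the cost of
    $q^{-a_{ij}}$. *)
Definition cartan (i j : int) : int := alpha j i - alpha j (i + 1).

Lemma cartan_diag i : cartan i i = 2.
Proof. by rewrite /cartan /alpha !eqxx; lia. Qed.

Lemma cartan_adj i j : `|i - j| = 1 -> cartan i j = -1.
Proof. by rewrite /cartan /alpha; lia. Qed.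

Lemma cartan_far i j : 1 < `|i - j| -> cartan i j = 0.
Proof. by rewrite /cartan /alpha; lia. Qed.

(* The relations of U(infinity) except for the commutation of distant E's, of
   distant F's, and the two quantum Serre relations. *)
Record preaction (k : fieldType) (q : k) (M : lmodType k) := Preaction {
  pE : int -> M -> M;
  pF : int -> M -> M;
  pK : int -> M -> M;
  pKi : int -> M -> M;
  pE_lin : forall i (a : k) (x y : M), pE i (a *: x + y) = a *: pE i x + pE i y;
  pF_lin : forall i (a : k) (x y : M), pF i (a *: x + y) = a *: pF i x + pF i y;
  pK_lin : forall i (a : k) (x y : M), pK i (a *: x + y) = a *: pK i x + pK i y;
  pKi_lin : forall i (a : k) (x y : M), pKi i (a *: x + y) = a *: pKi i x + pKi i y;
  pKK : forall i j x, pK i (pK j x) = pK j (pK i x);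
  pKKi : forall i x, pK i (pKi i x) = x;
  pKiK : forall i x, pKi i (pK i x) = x;
  pKE : forall i j x, pK i (pE j x) = q ^ alpha j i *: pE j (pK i x);
  pKF : forall i j x, pK i (pF j x) = q ^ (- alpha j i) *: pF j (pK i x);
  pEF : forall i j x,
    pE i (pF j x) - pF j (pE i x) =
    (i == j)%:R *: ((q - q^-1)^-1 *: (pK i (pKi (i + 1) x) - pK (i + 1) (pKi i x)))
}.

Section Preaction.
Variables (k : fieldType) (q : k) (M : lmodType k) (a : preaction q M).
Hypothesis q0 : q != 0.

Lemma inverse_comm (K Ki X : M -> M) (c : k) :
  (forall b x y, Ki (b *: x + y) = b *: Ki x + Ki y) ->
  (forall x, K (Ki x) = x) -> (forall x, Ki (K x) = x) -> c != 0 ->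
  (forall x, K (X x) = c *: X (K x)) ->
  forall x, Ki (X x) = c^-1 *: X (Ki x).
Proof.
move=> Ki_lin KKi KiK c0 KX x; rewrite -{1}(KKi x).
have -> : X (K (Ki x)) = c^-1 *: K (X (Ki x)).
  by rewrite KX scalerA mulVf // scale1r.
by rewrite (linZ Ki_lin) KiK.
Qed.

Lemma pKiE i j x : pKi a i (pE a j x) = q ^ (- alpha j i) *: pE a j (pKi a i x).
Proof.
rewrite -invr_expz.
apply: (inverse_comm (K := pK a i)).
- exact: pKi_lin.
- exact: pKKi.
- exact: pKiK.
- by rewrite expfz_eq0 negb_and q0 orbT.
- exact: pKE.
Qed.

Lemma pKiF i j x : pKi a i (pF a j x) = q ^ alpha j i *: pF a j (pKi a i x).
Proof.
rewrite -{1}[alpha j i]opprK -invr_expz.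
apply: (inverse_comm (K := pK a i)).
- exact: pKi_lin.
- exact: pKKi.
- exact: pKiK.
- by rewrite expfz_eq0 negb_and q0 orbT.
- exact: pKF.
Qed.

(** [pA i] is the action of $\widetilde K_i$ and [pB i] that of its inverse. They are separate
    because they pick up inverse powers of $q$ when moved past an $F_j$. *)
Definition pA i x := pK a i (pKi a (i + 1) x).
Definition pB i x := pK a (i + 1) (pKi a i x).

Lemma pAF i j x : pA i (pF a j x) = q ^ (- cartan i j) *: pF a j (pA i x).
Proof.
rewrite /pA pKiF (linZ (@pK_lin _ _ _ a i)) pKF scalerA -expfzDr //.
by congr (_ ^ _ *: _); rewrite /cartan; ring.
Qed.

Lemma pBF i j x : pB i (pF a j x) = q ^ cartan i j *: pF a j (pB i x).
Proof.
rewrite /pB pKiF (linZ (@pK_lin _ _ _ a (i + 1))) pKF scalerA -expfzDr //.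
Qed.

Lemma pEF_move i j x : pE a i (pF a j x) =
  pF a j (pE a i x) + (i == j)%:R *: ((q - q^-1)^-1 *: (pA i x - pB i x)).
Proof. by rewrite -(pEF a i j x) addrC subrK. Qed.

Lemma pKKi_comm i j x : pKi a j (pK a i x) = pK a i (pKi a j x).
Proof.
rewrite -[RHS]scale1r -invr1.
apply: (inverse_comm (K := pK a j)).
- exact: pKi_lin.
- exact: pKKi.
- exact: pKiK.
- exact: oner_neq0.
- by move=> y; rewrite scale1r pKK.
Qed.

(** The twist exchanges $E_i$ with $F_i$ and $K_i$ with $K_i^{-1}$. It is transparent, so that a
    lemma about the F's of the twist becomes, by conversion, one about the E's of [a]. *)
Definition chevalley : preaction q M.
Proof.
refine (@Preaction k q M (pF a) (pE a) (pKi a) (pK a) (@pF_lin _ _ _ a)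
  (@pE_lin _ _ _ a) (@pKi_lin _ _ _ a) (@pK_lin _ _ _ a) _ _ _ _ _ _).
- move=> i j x; set z := pKi a j (pKi a i x).
  by rewrite -[x](pKKi a i) -[pKi a i x](pKKi a j) -/z pKK !pKiK.
- exact: pKiK.
- exact: pKKi.
- exact: pKiF.
- exact: pKiE.
- move=> i j x; rewrite -opprB pEF eq_sym; case: eqP => [<-|_]; last first.
    by rewrite !scale0r oppr0.
  by rewrite !scale1r -scalerN opprB !pKKi_comm.
Defined.

End Preaction.

Lemma scale_funE (k : fieldType) (X : Type) (c : k) (f : X -> k^o) u :
  (c *: f) u = c * f u.
Proof. by []. Qed.

Lemma add_funE (k : fieldType) (X : Type) (f g : X -> k^o) u :
  (f + g) u = f u + g u.
Proof. by []. Qed.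

Lemma opp_funE (k : fieldType) (X : Type) (f : X -> k^o) u : (- f) u = - f u.
Proof. by []. Qed.

(** * Commutation of the Serre elements with the opposite generators *)

Section SerreCommutes.
Variables (k : fieldType) (q : k) (X : Type).
(** Vectors are functions so that identities between them can be checked pointwise by [ring] and
    [field]. *)
Let M : lmodType k := (X -> k^o).
Variable a : preaction q M.
Hypothesis q0 : q != 0.

Definition serreF i j (x : M) : M :=
  pF a i (pF a i (pF a j x)) - (q + q^-1) *: pF a i (pF a j (pF a i x)) +
  pF a j (pF a i (pF a i x)).

Definition commF i j (x : M) : M := pF a i (pF a j x) - pF a j (pF a i x).

(** Only $m=i$ and $m=j$ produce extra terms. There $\widetilde K_m^{\pm1}$ commutes with the other
    F, the Cartan entry being 0, so these terms cancel. *)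
Lemma pE_commF m i j x : 1 < `|i - j| ->
  pE a m (commF i j x) = commF i j (pE a m x).
Proof.
move=> ij; have ji : 1 < `|j - i| by rewrite distrC.
have iNj : (i == j) = false by apply/eqP => e; move: ij; rewrite e subrr normr0.
rewrite /commF (linB (@pE_lin _ _ _ a m)) !pEF_move !(linD (@pF_lin _ _ _ a _)).
rewrite !(linZ (@pF_lin _ _ _ a _)) !(linB (@pF_lin _ _ _ a _)).
rewrite !(pAF a q0) // !(pBF a q0) //.
have [->|_] := eqVneq m i; last have [->|_] := eqVneq m j.
- rewrite iNj (cartan_far ij) ?oppr0 !expr0z !scale1r !scale0r.
  by apply/funext => u; rewrite !(scale_funE, add_funE, opp_funE); ring.
- rewrite (cartan_far ji) ?oppr0 !expr0z !scale1r !scale0r.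
  by apply/funext => u; rewrite !(scale_funE, add_funE, opp_funE); ring.
- by rewrite !scale0r !addr0.
Qed.

(** The terms created by the relation between $E_m$ and $F_m$ are brought to a normal form with
    $\widetilde K_m^{\pm1}$ acting first; their coefficients then cancel. *)
Lemma pE_serreF m i j x : `|i - j| = 1 ->
  pE a m (serreF i j x) = serreF i j (pE a m x).
Proof.
move=> ij; have ji : `|j - i| = 1 by rewrite distrC.
have iNj : (i == j) = false by apply/eqP => e; move: ij; rewrite e subrr normr0.
rewrite /serreF (linD (@pE_lin _ _ _ a m)) (linB (@pE_lin _ _ _ a m)).
rewrite (linZ (@pE_lin _ _ _ a m)).
have Flin := (fun n => linD (@pF_lin _ _ _ a n), fun n => linZ (@pF_lin _ _ _ a n),
  fun n => linN (@pF_lin _ _ _ a n)).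
rewrite !pEF_move !(Flin, pEF_move); set c := (q - q^-1)^-1.
have [->|_] := eqVneq m i; last have [->|_] := eqVneq m j.
- rewrite iNj !scale0r !addr0 !scale1r.
  do 5! rewrite ?(Flin, pAF a q0, pBF a q0).
  rewrite !cartan_diag !(cartan_adj ij) opprK.
  rewrite (_ : q ^ 2 = q * q) // (_ : q ^ (-2) = (q * q)^-1) //.
  rewrite expr1z (_ : q ^ (-1) = q^-1) //.
  by apply/funext => u; rewrite !(scale_funE, add_funE, opp_funE); field.
(* For $m=j$ the coefficient of the $\widetilde K_j$ term is $1-(q+q^{-1})q+q^2=0$; the inverse term
   gives the same with $q^{-1}$ for $q$. *)
- rewrite !scale0r !addr0 !scale1r.
  do 5! rewrite ?(Flin, pAF a q0, pBF a q0).
  rewrite !(cartan_adj ji) opprK expr1z (_ : q ^ (-1) = q^-1) //.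
  by apply/funext => u; rewrite !(scale_funE, add_funE, opp_funE); field.
- by rewrite !scale0r !addr0.
Qed.

End SerreCommutes.

(** * The action on functions of words *)

Definition lower (la : weight) (w : seq int) : weight :=
  fun i => la i - \sum_(j <- w) alpha j i.

Lemma lower_nil la : lower la [::] = la.
Proof. by apply/funext => i; rewrite /lower big_nil subr0. Qed.

Lemma lower_cons la j w i : lower la (j :: w) i = lower la w i - alpha j i.
Proof. by rewrite /lower big_cons opprD addrCA addrC. Qed.

Section DualVerma.
Variables (k : fieldType) (q : k) (la : weight).
Hypothesis q0 : q != 0.
Let M : lmodType k := (seq int -> k^o).

(** The head of a word is the E applied first. The value at [w] sees only the component of weight
    [lower la w], which fixes the eigenvalues of the K's. *)
Definition dE (i : int) (phi : M) : M := fun w => phi (i :: w).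
Definition dK (i : int) (phi : M) : M := fun w => q ^ lower la w i * phi w.
Definition dKi (i : int) (phi : M) : M := fun w => q ^ (- lower la w i) * phi w.

(** The value at [w] of $(\widetilde K_j-\widetilde K_j^{-1})/(q-q^{-1})$ applied to [phi], the
    correction term in moving $E_j$ past $F_j$. *)
Definition dT (j : int) (phi : M) (w : seq int) : k :=
  (q - q^-1)^-1 * (dK j (dKi (j + 1) phi) w - dK (j + 1) (dKi j phi) w).

(* Recursion on the word by moving E_i to the right of F_j. *)
Fixpoint dFw (j : int) (w : seq int) (phi : M) : k :=
  if w is i :: w' then dFw j w' (dE i phi) + (i == j)%:R * dT i phi w' else 0.
Definition dF (j : int) (phi : M) : M := fun w => dFw j w phi.

Lemma dF_lin j c (x y : M) : dF j (c *: x + y) = c *: dF j x + dF j y.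
Proof.
apply/funext => w; rewrite add_funE scale_funE /dF.
elim: w x y => [|i w IH] x y /=; first by rewrite mulr0 addr0.
rewrite (_ : dE i (c *: x + y) = c *: dE i x + dE i y) // IH.
by rewrite /dT /dK /dKi !add_funE !scale_funE; ring.
Qed.

Let qD m n : q ^ m * q ^ n = q ^ (m + n). Proof. by rewrite expfzDr. Qed.

Lemma dKF i j (x : M) : dK i (dF j x) = q ^ (- alpha j i) *: dF j (dK i x).
Proof.
apply/funext => w; rewrite scale_funE /dF {1}/dK.
elim: w x => [|h w IH] x /=; first by rewrite !mulr0.
have -> : dE h (dK i x) = q ^ (- alpha h i) *: dK i (dE h x).
  apply/funext => u; rewrite scale_funE /dE /dK mulrA qD lower_cons.
  by rewrite addrC.
rewrite -[dFw j w (_ *: _)]/(dF j _ w) (linZ (@dF_lin j)) scale_funE /dF.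
rewrite !mulrDr; congr (_ + _).
  by rewrite mulrCA -IH mulrA qD lower_cons addrC.
have [->|] := eqVneq h j; last by rewrite !mul0r !mulr0.
rewrite lower_cons addrC -qD /dT /dK /dKi -!mulrA; congr (_ * _).
by rewrite !mul1r; ring.
Qed.

Definition dual_verma : preaction q M.
Proof.
refine (@Preaction k q M dE dF dK dKi _ dF_lin _ _ _ _ _ _ dKF _).
- by [].
- by move=> i c x y; apply/funext => w;
    rewrite add_funE scale_funE /dK add_funE scale_funE; ring.
- by move=> i c x y; apply/funext => w;
    rewrite add_funE scale_funE /dKi add_funE scale_funE; ring.
- by move=> i j x; apply/funext => w; rewrite /dK mulrCA.
- by move=> i x; apply/funext => w; rewrite /dK /dKi mulrA qD addrN expr0z mul1r.
- by move=> i x; apply/funext => w; rewrite /dK /dKi mulrA qD addNr expr0z mul1r.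
- move=> i j x; apply/funext => w; rewrite scale_funE /dE /dK mulrA qD lower_cons.
  by rewrite addrCA subrr addr0.
(* The relation between E and F is the recursive clause of [dFw] itself. *)
- move=> i j x; apply/funext => w; rewrite add_funE opp_funE !scale_funE.
  rewrite {1}/dE /dF /= addrAC subrr add0r.
  have [->|_] := eqVneq i j; last by rewrite !mul0r.
  by rewrite /dT add_funE opp_funE.
Defined.


(** The value of $Rx$ at [w] is the value at the empty word of $E_wRx=RE_wx$. *)
Lemma dual_verma_eq0 (R : M -> M) :
  (forall i x, R (dE i x) = dE i (R x)) -> (forall x, R x [::] = 0) ->
  forall x, R x = 0.
Proof.
move=> RE R0 x; apply/funext => w.
elim: w x => [|i w IH] x; first exact: R0.
by rewrite -[LHS]/(dE i (R x) w) -RE IH.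
Qed.

Lemma dual_verma_serreF i j x : `|i - j| = 1 -> serreF dual_verma i j x = 0.
Proof.
move=> ij; apply: (dual_verma_eq0 (R := serreF dual_verma i j)) => [m y|y].
  exact: esym (pE_serreF dual_verma q0 m y ij).
by rewrite /serreF !add_funE opp_funE scale_funE /= mulr0 oppr0 !addr0.
Qed.

Lemma dual_verma_commF i j x : 1 < `|i - j| -> commF dual_verma i j x = 0.
Proof.
move=> ij; apply: (dual_verma_eq0 (R := commF dual_verma i j)) => [m y|y].
  exact: esym (pE_commF dual_verma q0 m y ij).
by rewrite /commF !add_funE opp_funE /= oppr0 addr0.
Qed.

Definition dhw : M := fun w => (w == [::])%:R.

Lemma dhw_K i : dK i dhw = q ^ la i *: dhw.
Proof.
apply/funext => w; rewrite scale_funE /dK /dhw; case: w => [|h w].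
  by rewrite lower_nil.
by rewrite !mulr0.
Qed.

Lemma dual_verma_singular (x : M) : (forall i, dE i x = 0) -> x = x [::] *: dhw.
Proof.
move=> H; apply/funext => -[|i w]; rewrite scale_funE /dhw ?mulr1 ?mulr0 //.
by rewrite -[LHS]/(dE i x w) H.
Qed.

End DualVerma.

(* Vectors all of whose E-translates are killed by R: with R an E-Serre element
   these form a submodule, since R commutes with the F's. *)
Section EKilled.
Variables (k : fieldType) (q : k) (M : lmodType k) (a : preaction q M).
Variable R : M -> M.
Hypothesis q0 : q != 0.
Hypothesis R_lin : forall (c : k) x y, R (c *: x + y) = c *: R x + R y.
Hypothesis RF : forall i x, R (pF a i x) = pF a i (R x).
Hypothesis RK : forall i, exists c, forall x, R (pK a i x) = c *: pK a i (R x).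
Hypothesis RKi : forall i, exists c, forall x, R (pKi a i x) = c *: pKi a i (R x).

Definition Ekilled (x : M) : Prop :=
  forall w, R (foldl (fun y i => pE a i y) x w) = 0.

Lemma foldlE_lin w c x y : foldl (fun y i => pE a i y) (c *: x + y) w =
  c *: foldl (fun y i => pE a i y) x w + foldl (fun y i => pE a i y) y w.
Proof. by elim: w x y => [|i w IH] x y //=; rewrite pE_lin IH. Qed.

Lemma Ekilled_lin c x y : Ekilled x -> Ekilled y -> Ekilled (c *: x + y).
Proof. by move=> Hx Hy w; rewrite foldlE_lin R_lin Hx Hy scaler0 addr0. Qed.

Lemma Ekilled0 : Ekilled 0.
Proof.
move=> w; elim: w => [|i w IH] /=; first exact: lin0 R_lin.
by rewrite (lin0 (@pE_lin _ _ _ a i)).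
Qed.

Lemma EkilledZ c x : Ekilled x -> Ekilled (c *: x).
Proof.
move=> Hx; rewrite -[_ *: _]addr0; apply: Ekilled_lin => //; exact: Ekilled0.
Qed.

Lemma EkilledE i x : Ekilled x -> Ekilled (pE a i x).
Proof. by move=> Hx w; apply: (Hx (i :: w)). Qed.

Lemma EkilledK i x : Ekilled x -> Ekilled (pK a i x).
Proof.
move=> Hx w; elim: w x Hx => [|j w IH] x Hx /=.
  by have [c ->] := RK i; rewrite (Hx [::]) (lin0 (@pK_lin _ _ _ a i)) scaler0.
have -> : pE a j (pK a i x) = pK a i (q ^ (- alpha j i) *: pE a j x).
  rewrite (linZ (@pK_lin _ _ _ a i)) pKE scalerA -expfzDr // addNr expr0z.
  by rewrite scale1r.
by apply: IH; apply/EkilledZ/EkilledE.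
Qed.

Lemma EkilledKi i x : Ekilled x -> Ekilled (pKi a i x).
Proof.
move=> Hx w; elim: w x Hx => [|j w IH] x Hx /=.
  by have [c ->] := RKi i; rewrite (Hx [::]) (lin0 (@pKi_lin _ _ _ a i)) scaler0.
have -> : pE a j (pKi a i x) = pKi a i (q ^ alpha j i *: pE a j x).
  rewrite (linZ (@pKi_lin _ _ _ a i)) (pKiE a q0) scalerA -expfzDr // addrN expr0z.
  by rewrite scale1r.
by apply: IH; apply/EkilledZ/EkilledE.
Qed.

(** The relation writes $E_jF_ix$ as $F_iE_jx$ plus multiples of K-translates of $x$. The latter are
    covered by the previous lemmas, the former by induction on the word. *)
Lemma EkilledF i x : Ekilled x -> Ekilled (pF a i x).
Proof.
move=> Hx w; elim: w x Hx => [|j w IH] x Hx /=.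
  by rewrite RF (Hx [::]) (lin0 (@pF_lin _ _ _ a i)).
rewrite pEF_move [_ + _]addrC scalerA scalerBr -addrA -scaleN1r.
rewrite foldlE_lin R_lin (EkilledK _ (EkilledKi _ Hx)) scaler0 add0r.
rewrite foldlE_lin R_lin (EkilledZ _ (EkilledK _ (EkilledKi _ Hx))) scaler0 add0r.
by apply: IH; apply: EkilledE.
Qed.

End EKilled.

(** * Serre elements and the Cartan part; stability of the vectors they kill *)

Section SerreSemicommutes.
Variables (k : fieldType) (q : k) (X : Type).
Let M : lmodType k := (X -> k^o).
Variable a : preaction q M.
Hypothesis q0 : q != 0.

Lemma serreF_lin i j c x y :
  serreF a i j (c *: x + y) = c *: serreF a i j x + serreF a i j y.
Proof.
rewrite /serreF !pF_lin.
by apply/funext => u; rewrite !(scale_funE, add_funE, opp_funE); ring.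
Qed.

Lemma commF_lin i j c x y :
  commF a i j (c *: x + y) = c *: commF a i j x + commF a i j y.
Proof.
by rewrite /commF !pF_lin opprD addrACA scalerBr.
Qed.

Section Semicommutes.
Variables (Y : M -> M) (c : int -> k).
Hypothesis Y_lin : forall d x y, Y (d *: x + y) = d *: Y x + Y y.
Hypothesis FY : forall n x, pF a n (Y x) = c n *: Y (pF a n x).

(** Every term contains $F_i$ twice and $F_j$ once, so all of them acquire the same scalar. This is
    applied with [Y] one of the $K_m^{\pm1}$. *)
Lemma serreF_semi i j x :
  serreF a i j (Y x) = (c i * c i * c j) *: Y (serreF a i j x).
Proof.
have FZ := fun n => linZ (@pF_lin _ _ _ a n).
rewrite /serreF !(FY, FZ) (linD Y_lin) (linB Y_lin) (linZ Y_lin).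
by apply/funext => u; rewrite !(scale_funE, add_funE, opp_funE); ring.
Qed.

Lemma commF_semi i j x : commF a i j (Y x) = (c i * c j) *: Y (commF a i j x).
Proof.
have FZ := fun n => linZ (@pF_lin _ _ _ a n).
rewrite /commF !(FY, FZ) (linB Y_lin).
by apply/funext => u; rewrite !(scale_funE, add_funE, opp_funE); ring.
Qed.

End Semicommutes.

Lemma pFK n m x : pF a n (pK a m x) = q ^ alpha n m *: pK a m (pF a n x).
Proof. by rewrite pKF scalerA -expfzDr // addrN expr0z scale1r. Qed.

Lemma pFKi n m x : pF a n (pKi a m x) = q ^ (- alpha n m) *: pKi a m (pF a n x).
Proof. by rewrite (pKiF a q0) scalerA -expfzDr // addNr expr0z scale1r. Qed.

End SerreSemicommutes.

Section Orbit.
Variables (k : fieldType) (q : k) (X : Type).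
Let M : lmodType k := (X -> k^o).
Variable a : preaction q M.
Hypothesis q0 : q != 0.
Let b := chevalley a q0.

(* The E-relations of a are the F-relations of its Chevalley twist b. *)
Lemma Ekilled_orbit (R : M -> M) (P := Ekilled a R) :
  (exists i j, (1 < `|i - j| /\ R = commF b i j) \/
     (`|i - j| = 1 /\ R = serreF b i j)) ->
  [/\ forall i x, P x -> P (pE a i x), forall i x, P x -> P (pF a i x),
      forall i x, P x -> P (pK a i x), forall i x, P x -> P (pKi a i x) &
      forall c x y, P x -> P y -> P (c *: x + y)].
Proof.
move=> [i [j Rij]].
have R_lin c x y : R (c *: x + y) = c *: R x + R y.
  by case: Rij => -[_ ->]; [apply: commF_lin | apply: serreF_lin].
(* [pF a] is [pE b], and the Serre elements in the F's of [b] commute with the E's of [b]. *)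
have RF m x : R (pF a m x) = pF a m (R x).
  by case: Rij => -[ij ->]; rewrite -[pF a m]/(pE b m);
    [rewrite (pE_commF b q0) | rewrite (pE_serreF b q0)].
have RK m : exists c, forall x, R (pK a m x) = c *: pK a m (R x).
  rewrite -[pK a m]/(pKi b m); case: Rij => -[ij ->]; eexists => x;
    [rewrite (commF_semi (c := fun n => q ^ (- alpha n m))) // 
    | rewrite (serreF_semi (c := fun n => q ^ (- alpha n m))) //];
    solve [exact: pKi_lin | by move=> n y; apply: pFKi].
have RKi m : exists c, forall x, R (pKi a m x) = c *: pKi a m (R x).
  rewrite -[pKi a m]/(pK b m); case: Rij => -[ij ->]; eexists => x;
    [rewrite (commF_semi (c := fun n => q ^ (alpha n m))) // 
    | rewrite (serreF_semi (c := fun n => q ^ (alpha n m))) //];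
    solve [exact: pK_lin | by move=> n y; apply: pFK].
split=> *; [apply: EkilledE|apply: EkilledF|apply: EkilledK|apply: EkilledKi|
  apply: Ekilled_lin] => //.
Qed.

End Orbit.

(** * Cyclic modules as quotients of formal expressions *)

Lemma v_neq0 : v != 0.
Proof. by rewrite /v tofrac_eq0 polyX_eq0. Qed.

Definition preaction_of (M : lmodType Qv) (a : Uaction M) : preaction v M.
Proof.
refine (@Preaction Qv v M (uE a) (uF a) (uK a) (uKi a) (@uE_lin _ a) (@uF_lin _ a)
  (@uK_lin _ a) (@uKi_lin _ a) (@uKK _ a) (@uKKi _ a) (@uKiK _ a) (@uKE _ a) _
  (@uEF _ a)).
by move=> i j x; rewrite uKF opprB.
Defined.

Definition gen : Type := (bool * bool * int)%type.
Notation gE i := (true, true, i).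
Notation gF i := (true, false, i).
Notation gK i := (false, true, i).
Notation gKi i := (false, false, i).

Definition gact (M : lmodType Qv) (a : preaction v M) (g : gen) : M -> M :=
  match g with
  | gE i => pE a i | gF i => pF a i | gK i => pK a i | gKi i => pKi a i
  end.

Lemma gact_lin (M : lmodType Qv) (a : preaction v M) g c x y :
  gact a g (c *: x + y) = c *: gact a g x + gact a g y.
Proof.
by case: g => [[[] []] i]; [exact: pE_lin|exact: pF_lin|exact: pK_lin|exact: pKi_lin].
Qed.

(** Elements of the free algebra on the generators, unreduced: different lists may denote the same
    element. *)
Definition formal : Type := seq (Qv * seq gen).

Section Eval.
Variables (M : lmodType Qv) (a : preaction v M) (n : M).

Definition wact (w : seq gen) : M := foldr (fun g y => gact a g y) n w.
Definition eval (t : formal) : M := \sum_(p <- t) p.1 *: wact p.2.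

Definition fscale (c : Qv) (t : formal) : formal := [seq (c * p.1, p.2) | p <- t].
Definition fgact (g : gen) (t : formal) : formal := [seq (p.1, g :: p.2) | p <- t].

Lemma eval_cat t u : eval (t ++ u) = eval t + eval u.
Proof. by rewrite /eval big_cat. Qed.

Lemma eval_fscale c t : eval (fscale c t) = c *: eval t.
Proof.
by rewrite /eval big_map scaler_sumr; apply: eq_bigr => p _; rewrite scalerA.
Qed.

Lemma eval_fgact g t : eval (fgact g t) = gact a g (eval t).
Proof.
rewrite /eval big_map (lin_sum (@gact_lin _ a g)).
by apply: eq_bigr => p _; rewrite (linZ (@gact_lin _ a g)).
Qed.

Lemma eval_closed (P : M -> Prop) : P 0 -> P n ->
  (forall c x y, P x -> P y -> P (c *: x + y)) ->
  (forall g x, P x -> P (gact a g x)) -> forall t, P (eval t).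
Proof.
move=> P0 Pn PL Pg; elim=> [|[c w] t IH]; first by rewrite /eval big_nil.
rewrite /eval big_cons; apply: PL => //=.
by elim: w => [|g w IHw] //=; apply: Pg.
Qed.

End Eval.

(* The cyclic submodule generated by (n_k)_k in the product of the N_k, built as
   a quotient of formal expressions to keep it in a small universe. *)
Section Cyclic.
Variables (I : Type) (N : I -> lmodType Qv) (a : forall k, preaction v (N k)).
Variable n : forall k, N k.
Let ev k := eval (a k) (n k).

Definition cyc_eqv (t u : formal) : bool := `[< forall k, ev k t = ev k u >].

Lemma cyc_eqv_refl : reflexive cyc_eqv.
Proof. by move=> t; apply/asboolP. Qed.

Lemma cyc_eqv_sym : symmetric cyc_eqv.
Proof. by move=> t u; apply/asboolP/asboolP => H k; rewrite H. Qed.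

Lemma cyc_eqv_trans : transitive cyc_eqv.
Proof. by move=> t u w /asboolP H1 /asboolP H2; apply/asboolP => k; rewrite H1. Qed.

Canonical cyc_equiv := EquivRel cyc_eqv cyc_eqv_refl cyc_eqv_sym cyc_eqv_trans.

Definition cyc : Type := {eq_quot cyc_equiv}.
HB.instance Definition _ := Choice.on cyc.

Definition cpi (t : formal) : cyc := (\pi_{eq_quot cyc_equiv} t).
Definition crepr (x : cyc) : formal := @repr _ {eq_quot cyc_equiv} x.
Definition cev k (x : cyc) : N k := ev k (crepr x).

Lemma cev_pi k t : cev k (cpi t) = ev k t.
Proof.
have /eqP : cpi (crepr (cpi t)) = cpi t by rewrite /cpi /crepr reprK.
by rewrite /cpi eqmodE => /asboolP /(_ k).
Qed.

(** This reduces every module axiom and relation on [cyc] to the coordinates. *)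
Lemma cev_inj x y : (forall k, cev k x = cev k y) -> x = y.
Proof.
move=> H; rewrite -[x](@reprK _ {eq_quot cyc_equiv}) -[y](@reprK _ {eq_quot cyc_equiv}).
by apply/eqP; rewrite eqmodE; apply/asboolP.
Qed.

Definition czero : cyc := cpi [::].
Definition cadd (x y : cyc) : cyc := cpi (crepr x ++ crepr y).
Definition cscale (c : Qv) (x : cyc) : cyc := cpi (fscale c (crepr x)).
Definition copp : cyc -> cyc := cscale (- 1).
Definition cact (g : gen) (x : cyc) : cyc := cpi (fgact g (crepr x)).

Lemma cev0 k : cev k czero = 0.
Proof. by rewrite cev_pi /ev /eval big_nil. Qed.

Lemma cevD k x y : cev k (cadd x y) = cev k x + cev k y.
Proof. by rewrite cev_pi /ev eval_cat. Qed.

Lemma cevZ k c x : cev k (cscale c x) = c *: cev k x.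
Proof. by rewrite cev_pi /ev eval_fscale. Qed.

Lemma cevN k x : cev k (copp x) = - cev k x.
Proof. by rewrite cevZ scaleN1r. Qed.

Lemma cev_act k g x : cev k (cact g x) = gact (a k) g (cev k x).
Proof. by rewrite cev_pi /ev eval_fgact. Qed.

Fact caddA : associative cadd.
Proof. by move=> x y z; apply: cev_inj => k; rewrite !cevD addrA. Qed.
Fact caddC : commutative cadd.
Proof. by move=> x y; apply: cev_inj => k; rewrite !cevD addrC. Qed.
Fact cadd0 : left_id czero cadd.
Proof. by move=> x; apply: cev_inj => k; rewrite !cevD cev0 add0r. Qed.
Fact caddN : left_inverse czero copp cadd.
Proof. by move=> x; apply: cev_inj => k; rewrite !cevD cevN cev0 addNr. Qed.

HB.instance Definition _ := GRing.isZmodule.Build cyc caddA caddC cadd0 caddN.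

Fact cscaleA c d x : cscale c (cscale d x) = cscale (c * d) x.
Proof. by apply: cev_inj => k; rewrite !cevZ scalerA. Qed.
Fact cscale1 : left_id 1 cscale.
Proof. by move=> x; apply: cev_inj => k; rewrite cevZ scale1r. Qed.
Fact cscaleDr : right_distributive cscale +%R.
Proof. by move=> c x y; apply: cev_inj => k; rewrite !(cevD, cevZ) scalerDr. Qed.
Fact cscaleDl x : {morph cscale^~ x : c d / c + d}.
Proof. by move=> c d; apply: cev_inj => k; rewrite !(cevD, cevZ) scalerDl. Qed.

HB.instance Definition _ :=
  GRing.Zmodule_isLmodule.Build Qv cyc cscaleA cscale1 cscaleDr cscaleDl.

Lemma cev_lin k (c : Qv) (x y : cyc) : cev k (c *: x + y) = c *: cev k x + cev k y.
Proof. by rewrite -cevZ -cevD. Qed.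

Lemma cact_lin g (c : Qv) (x y : cyc) : cact g (c *: x + y) = c *: cact g x + cact g y.
Proof. by apply: cev_inj => k; rewrite !(cev_act, cev_lin) gact_lin. Qed.

(** The relations are asked only at evaluations on the generator: in [dual_verma] those among the
    E's are established on the orbit of the indicator alone. *)
Hypothesis relEE : forall k i j t, 1 < `|i - j| ->
  pE (a k) i (pE (a k) j (ev k t)) = pE (a k) j (pE (a k) i (ev k t)).
Hypothesis relFF : forall k i j t, 1 < `|i - j| ->
  pF (a k) i (pF (a k) j (ev k t)) = pF (a k) j (pF (a k) i (ev k t)).
Hypothesis relSerreE : forall k i j t (e := pE (a k)), `|i - j| = 1 ->
  e i (e i (e j (ev k t))) - (v + v^-1) *: e i (e j (e i (ev k t)))
  + e j (e i (e i (ev k t))) = 0.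
Hypothesis relSerreF : forall k i j t (e := pF (a k)), `|i - j| = 1 ->
  e i (e i (e j (ev k t))) - (v + v^-1) *: e i (e j (e i (ev k t)))
  + e j (e i (e i (ev k t))) = 0.

Let cevE := (cev_act, fun k => linD (@cev_lin k), fun k => linZ (@cev_lin k),
  fun k => linN (@cev_lin k), fun k => lin0 (@cev_lin k)).

Definition cyc_action : Uaction cyc.
Proof.
refine (@Build_Uaction cyc (fun i => cact (gE i)) (fun i => cact (gF i))
   (fun i => cact (gK i)) (fun i => cact (gKi i)) (fun i => @cact_lin (gE i))
   (fun i => @cact_lin (gF i)) (fun i => @cact_lin (gK i))
   (fun i => @cact_lin (gKi i)) _ _ _ _ _ _ _ _ _ _).
- by move=> i j x; apply: cev_inj => k; rewrite !cevE /= pKK.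
- by move=> i x; apply: cev_inj => k; rewrite !cevE /= pKKi.
- by move=> i x; apply: cev_inj => k; rewrite !cevE /= pKiK.
- by move=> i j x; apply: cev_inj => k; rewrite !cevE /= pKE.
- by move=> i j x; apply: cev_inj => k; rewrite !cevE /= pKF opprB.
- by move=> i j x ij; apply: cev_inj => k; rewrite !cevE /= relEE.
- by move=> i j x ij; apply: cev_inj => k; rewrite !cevE /= relFF.
- by move=> i j x; apply: cev_inj => k; rewrite !cevE /= !scaleN1r pEF.
- by move=> i j x ij; apply: cev_inj => k; rewrite !cevE /= scaleN1r relSerreE.
- by move=> i j x ij; apply: cev_inj => k; rewrite !cevE /= scaleN1r relSerreF.
Defined.

Definition cgen : cyc := cpi [:: (1, [::])].

Lemma cev_gen k : cev k cgen = n k.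
Proof. by rewrite cev_pi /ev /eval big_seq1 scale1r. Qed.

Lemma cyc_generated (P : cyc -> Prop) :
  submodule cyc_action P -> P cgen -> forall x, P x.
Proof.
move=> [P0 [PD [PZ Pact]]] Pg x.
have Pg' g y : P y -> P (cact g y).
  by case: g => [[[] []] i] /(Pact i) [? [? []]].
(* An element is the value on the generator of its own representative. *)
have -> : x = eval (preaction_of cyc_action) cgen (crepr x).
  apply: cev_inj => k; rewrite {1}/cev /ev /eval (lin_sum (@cev_lin k)).
  apply: eq_bigr => p _; rewrite (linZ (@cev_lin k)); congr (_ *: _).
  elim: p.2 => [|g w /= ->]; first by rewrite /= cev_gen.
  by rewrite -cev_act; case: g => [[[] []] i].
apply: eval_closed => //.
- by move=> c y z Py Pz; apply: PD => //; apply: PZ.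
- by move=> [[[] []] i] y Py; rewrite /=; apply: (Pg' (_, _, i)).
Qed.

End Cyclic.

(** * Weight spaces *)

Lemma vX_neq1 (n : nat) : v ^+ n.+1 != 1.
Proof.
rewrite /v -tofracXn -tofrac1 tofrac_eq.
by apply/eqP => /(congr1 (fun p : {poly rat} => size p));
  rewrite size_polyXn size_poly1.
Qed.

Lemma vz_eq1 (n : int) : (v ^ n == 1) = (n == 0).
Proof.
case: n => [[|n]|n]; first by rewrite expr0z !eqxx.
- exact: negbTE (vX_neq1 n).
- by rewrite NegzE -invr_expz invr_eq1; apply: negbTE (vX_neq1 n).
Qed.

(** As $v$ is not a root of unity, the eigenvalue of $K_i$ determines the $i$-th entry of a
    weight. *)
Lemma vz_inj : injective (fun n : int => v ^ n).
Proof.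
move=> m n /= e; apply/eqP; rewrite -subr_eq0 -vz_eq1 expfzDr ?v_neq0 //.
by rewrite e -expfzDr ?v_neq0 // addrN expr0z.
Qed.

(** Partial sums of $\alpha_i$ telescope to a delta at $i$, so partial sums of $\sum_{i\in
    s}\alpha_i$ recover multiplicities in $s$. The finite list [L] stands in for $\mathbb Z$. *)
Lemma sum_alpha_prefix (L : seq int) (i l : int) : uniq L -> i \in L -> i + 1 \in L ->
  \sum_(j <- L | j <= l) alpha i j = (l == i)%:Z.
Proof.
move=> uL iL i1L; rewrite big_mkcond /=.
have delta (h : int) : h \in L ->
    \sum_(j <- L) (if j <= l then (j == h)%:Z else 0) = (h <= l)%R%:Z.
  move=> hL; rewrite (bigD1_seq h) //= eqxx big1 => [|j /negbTE ->]; last by case: ifP.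
  by rewrite addr0; case: ifP.
transitivity ((i <= l)%R%:Z - (i + 1 <= l)%R%:Z); last by lia.
rewrite -(delta _ iL) -(delta _ i1L) -sumrB; apply: eq_bigr => j _.
by rewrite /alpha; case: ifP => _; rewrite ?subr0.
Qed.

Lemma count_sum_alpha (L s : seq int) (l : int) : uniq L ->
  {subset s <= L} -> {subset [seq i + 1 | i <- s] <= L} ->
  \sum_(j <- L | j <= l) \sum_(i <- s) alpha i j = (count_mem l s)%:Z.
Proof.
move=> uL; rewrite exchange_big /=; elim: s => [|i s IH] sL sL1.
  by rewrite big_nil.
rewrite big_cons IH.
- rewrite sum_alpha_prefix //; first by rewrite /= PoszD eq_sym.
    by rewrite sL ?mem_head.
  by rewrite sL1 ?mem_head.
- by move=> h hs; rewrite sL // inE hs orbT.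
- by move=> h hs; rewrite sL1 // inE hs orbT.
Qed.

Lemma sum_alpha_perm (s t : seq int) :
  (forall j, \sum_(i <- s) alpha i j = \sum_(i <- t) alpha i j) -> perm_eq s t.
Proof.
move=> H; apply/permP => /= p; rewrite -!sum1_count.
(* [L] covers the supports of all $\alpha_i$ involved, namely each $i$ and $i+1$. *)
pose L := undup (s ++ t ++ [seq i + 1 | i <- s ++ t]).
have cnt l : count_mem l s = count_mem l t.
  apply/eqP; rewrite -eqz_nat -!(@count_sum_alpha L) ?undup_uniq //; last first.
  - by move=> h; rewrite /L mem_undup !mem_cat map_cat mem_cat => ->; rewrite ?orbT.
  - by move=> h; rewrite /L mem_undup !mem_cat => ->; rewrite ?orbT.
  - by move=> h; rewrite /L mem_undup !mem_cat map_cat mem_cat => ->; rewrite ?orbT.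
  - by move=> h; rewrite /L mem_undup !mem_cat => ->; rewrite ?orbT.
  by apply/eqP/eq_bigr => j _; apply: H.
by apply/perm_big; apply/allP => l _; rewrite /= cnt.
Qed.

Lemma lower_perm la s t : lower la s = lower la t -> perm_eq s t.
Proof.
move=> /(congr1 (fun f : weight => f _)) H; apply: sum_alpha_perm => j.
by move: (H j) => /addrI /oppr_inj.
Qed.

Lemma le_wtP mu la : le_wt mu la <-> exists s, mu = lower la s.
Proof.
split=> -[s H]; exists s; first by apply/funext => j; rewrite /lower -H; ring.
by move=> j; rewrite H /lower; ring.
Qed.

(** Composing both descents returns to [la] along [s ++ t]; by independence of the $\alpha_i$ this
    word is empty. *)
Lemma le_wt_anti la mu : le_wt mu la -> le_wt la mu -> la = mu.
Proof.
move=> /le_wtP [s ->] /le_wtP [t].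
rewrite -{1}[la]lower_nil => e.
have /lower_perm/perm_size : lower la [::] = lower la (s ++ t).
  by rewrite e; apply/funext => j; rewrite /lower big_cat /=; ring.
by rewrite size_cat; case: s {e} => //; rewrite lower_nil.
Qed.

Section WeightSpaces.
Variables (M : lmodType Qv) (a : Uaction M).

Definition wvecs (s : seq (weight * M)) : Prop :=
  forall p, inL p s -> in_wspace a p.1 p.2.

Lemma wspace_lin la c x y : in_wspace a la x -> in_wspace a la y ->
  in_wspace a la (c *: x + y).
Proof. by move=> Hx Hy i; rewrite uK_lin Hx Hy scalerDr !scalerA mulrC. Qed.

Lemma wspace0 la : in_wspace a la 0.
Proof. by move=> i; rewrite (lin0 (@uK_lin _ a i)) scaler0. Qed.

Lemma wspaceZ la c x : in_wspace a la x -> in_wspace a la (c *: x).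
Proof.
move=> Hx; rewrite -[_ *: _]addr0; apply: wspace_lin => //; exact: wspace0.
Qed.

Lemma wspaceB la x y : in_wspace a la x -> in_wspace a la y -> in_wspace a la (x - y).
Proof. by move=> Hx Hy; rewrite addrC -scaleN1r; apply: wspace_lin. Qed.

Lemma wspace_sum la (s : seq (weight * M)) (P : pred (weight * M)) :
  wvecs s -> (forall p, P p -> p.1 = la) -> in_wspace a la (\sum_(p <- s | P p) p.2).
Proof.
move=> + HP; elim: s => [|p s IH] Hs; first by rewrite big_nil; apply: wspace0.
have Ws : in_wspace a la (\sum_(p <- s | P p) p.2).
  by apply: IH => r rs; apply: Hs; right.
rewrite big_cons; case: ifP => // Pp.
by rewrite -[p.2]scale1r; apply: wspace_lin => //; rewrite -(HP _ Pp); apply: Hs; left.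
Qed.

(** Eigenspace separation by induction on the number of terms. With $i$ separating [mu] from the
    first weight [p.1], the operator $K_i-v^{p.1(i)}$ kills the first term, rescales the others, and
    multiplies the sum by a nonzero scalar. *)
Lemma wspace_disjoint mu (s : seq (weight * M)) : wvecs s ->
  (forall p, inL p s -> p.1 <> mu) ->
  in_wspace a mu (\sum_(p <- s) p.2) -> \sum_(p <- s) p.2 = 0.
Proof.
move: {2}(size s) (erefl (size s)) => n; elim: n s => [|n IH] [|p s] //= sz Hs Hmu Wy.
  by rewrite big_nil.
have [i Hi] : exists i, p.1 i != mu i.
  apply: contrapT => H; apply: (Hmu p); first by left.
  by apply/funext => i; apply: contrapT => /eqP e; apply: H; exists i.
set y := \sum_(q <- p :: s) q.2 in Wy *.
pose s' := [seq (q.1, (v ^ (q.1 i) - v ^ (p.1 i)) *: q.2) | q <- s].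
have inLs q : inL q s' -> exists2 q0, inL q0 s &
    q = (q0.1, (v ^ (q0.1 i) - v ^ (p.1 i)) *: q0.2).
  rewrite /s'; elim: (s) => [|h t IHt] //= [<-|/IHt [q0 q0t ->]].
    by exists h => //; left.
  by exists q0 => //; right.
have E : (v ^ mu i - v ^ p.1 i) *: y = \sum_(q <- s') q.2.
  rewrite scalerBl -Wy /y (lin_sum (@uK_lin _ a i)) scaler_sumr -sumrB big_cons.
  rewrite (Hs p) ?subrr ?add0r; last by left.
  rewrite /s' big_map; elim: (s) Hs => [|q t IHt] Hs; first by rewrite !big_nil.
  rewrite !big_cons IHt; last by move=> r /= [<-|rt]; apply: Hs; [left|right; right].
  by rewrite (Hs q) ?scalerBl //; right; left.
have y0 : (v ^ mu i - v ^ p.1 i) *: y = 0.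
  rewrite E; apply: (IH s').
  - by rewrite /s' size_map; case: sz.
  - by move=> q /inLs [q0 q0s ->] /=; apply: wspaceZ; apply: Hs; right.
  - by move=> q /inLs [q0 q0s ->] /=; apply: Hmu; right.
  - by rewrite -E; apply: wspaceZ.
move/eqP: y0; rewrite scaler_eq0 subr_eq0 => /orP [/eqP /vz_inj e|/eqP //].
by rewrite e eqxx in Hi.
Qed.

(** The terms of the other weights add up to a vector that also has weight [mu], hence to 0. *)
Lemma wspace_component mu (s : seq (weight * M)) : wvecs s ->
  in_wspace a mu (\sum_(p <- s) p.2) ->
  \sum_(p <- s) p.2 = \sum_(p <- s | `[< p.1 = mu >]) p.2.
Proof.
move=> Hs Wx; apply/eqP; rewrite -subr_eq0.
set x := \sum_(p <- s) p.2 in Wx *.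
have -> : x - \sum_(p <- s | `[< p.1 = mu >]) p.2 =
    \sum_(p <- [seq p <- s | ~~ `[< p.1 = mu >]]) p.2.
  by rewrite /x (bigID (fun p => `[< p.1 = mu >])) /= addrAC subrr add0r big_filter.
have sub p : inL p [seq p <- s | ~~ `[< p.1 = mu >]] -> inL p s /\ p.1 <> mu.
  elim: (s) => [|q t IHt] //=.
  case: ifP => [/asboolPn Hq [<-|/IHt []]|_ /IHt []]; by tauto.
apply/eqP/(@wspace_disjoint mu).
- by move=> p /sub [/Hs].
- by move=> p /sub [].
- rewrite big_filter
    (_ : \sum_(_ <- _ | _) _ = x - \sum_(p <- s | `[< p.1 = mu >]) p.2).
    by apply: wspaceB => //; apply: wspace_sum => // p /asboolP.
  by rewrite /x [in RHS](bigID (fun p => `[< p.1 = mu >])) /= addrAC subrr add0r.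
Qed.

Lemma wspaceE mu i x : in_wspace a mu x ->
  in_wspace a (fun j => mu j + alpha i j) (uE a i x).
Proof.
move=> H j; rewrite uKE H (linZ (@uE_lin _ a i)) scalerA -expfzDr ?v_neq0 //.
by rewrite addrC.
Qed.

Lemma wspaceF mu i x : in_wspace a mu x ->
  in_wspace a (fun j => mu j - alpha i j) (uF a i x).
Proof.
move=> H j; rewrite uKF H (linZ (@uF_lin _ a i)) scalerA -expfzDr ?v_neq0 //.
by rewrite addrC /alpha opprB.
Qed.

Lemma wspaceKi mu i x : in_wspace a mu x -> uKi a i x = v ^ (- mu i) *: x.
Proof.
move=> H; rewrite -{2}(uKiK a i x) H (linZ (@uKi_lin _ a i)) scalerA.
by rewrite -expfzDr ?v_neq0 // addNr expr0z scale1r.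
Qed.

(** The quantum integer $[n]$. *)
Definition qnum (n : int) : Qv := (v - v^-1)^-1 * (v ^ n - v ^ (- n)).

Lemma uEF_wspace mu i j x : in_wspace a mu x ->
  uE a i (uF a j x) = uF a j (uE a i x) + ((i == j)%:R * qnum (mu i - mu (i + 1))) *: x.
Proof.
move=> H; apply/eqP; rewrite addrC -subr_eq uEF; apply/eqP.
rewrite -scalerA; congr (_ *: _); rewrite /qnum -scalerA; congr (_ *: _).
rewrite (wspaceKi _ H) (wspaceKi _ H) !(linZ (@uK_lin _ a _)) !H !scalerA.
by rewrite -!expfzDr ?v_neq0 // -scalerBl opprB
  [- mu (i + 1) + _]addrC [- mu i + _]addrC.
Qed.

End WeightSpaces.

(** * Highest weight vectors *)

Lemma v2_neq1 : v ^+ 2 != 1.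
Proof. exact: vX_neq1. Qed.

Lemma qnum_eq0 n : (qnum n == 0) = (n == 0).
Proof.
rewrite /qnum mulf_eq0 invr_eq0 !subr_eq0.
have -> : (v == v^-1) = false.
  apply/negbTE; apply: contraNneq v2_neq1 => e.
  by rewrite expr2 {2}e mulfV ?v_neq0.
apply/eqP/eqP => [/vz_inj|->]; last by rewrite oppr0.
lia.
Qed.

Lemma qnum_product_rec (k : fieldType) (q a b : k) (c := (q - q^-1)^-1) :
  q != 0 -> a != 0 -> b != 0 ->
  (c * (a - a^-1)) * (c * (b * a^-1 * q - (b * a^-1 * q)^-1)) +
    c * (b * a^-1 * a^-1 - (b * a^-1 * a^-1)^-1) =
  (c * (a * q - (a * q)^-1)) * (c * (b * a^-1 - (b * a^-1)^-1)).
Proof.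
move=> q0 a0 b0.
(* If $q=q^{-1}$, then [c] is $0^{-1}=0$ and both sides vanish. *)
have [e|ne] := eqVneq (q - q^-1) 0; first by rewrite /c e invr0; ring.
rewrite /c; field; rewrite q0 a0 b0 /=.
apply: contraNneq ne => e; apply/eqP.
have -> : q - q^-1 = q^-1 * (q * q - 1) by field.
by rewrite e mulr0.
Qed.

(** The inductive step of the $\mathfrak{sl}_2$ formula for $E_iF_i^{n+1}$; the rational identity is
    used with $a=v^n$ and $b=v^l$. *)
Lemma qnum_rec (n l : int) :
  qnum n * qnum (l - n + 1) + qnum (l - n - n) = qnum (n + 1) * qnum (l - n).
Proof.
have v0 (z : int) : v ^ z != 0 by rewrite expfz_eq0 negb_and v_neq0 orbT.
have vD (x y : int) : v ^ (x + y) = v ^ x * v ^ y by rewrite expfzDr ?v_neq0.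
have vB (x y : int) : v ^ (x - y) = v ^ x * (v ^ y)^-1 by rewrite vD -invr_expz.
rewrite /qnum -!invr_expz !(vB, vD) expr1z.
exact: qnum_product_rec v_neq0 (v0 n) (v0 l).
Qed.

Section HighestWeight.
Variables (M : lmodType Qv) (a : Uaction M) (la : weight) (m : M).
Hypothesis Wm : in_wspace a la m.
Hypothesis Em : forall i, uE a i m = 0.

Definition Fword (w : seq int) : M := foldr (fun i y => uF a i y) m w.

Lemma Fword_wspace w : in_wspace a (lower la w) (Fword w).
Proof.
elim: w => [|i w IH]; first by rewrite lower_nil.
rewrite (_ : lower la _ = fun j => lower la w j - alpha i j); last first.
  by apply/funext => j; rewrite lower_cons.
exact: wspaceF.
Qed.

(** A filtration by word length: F's raise the level by one, E's lower it by one, K's preserve it.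
    The strict bound makes level 0 the zero space, so long E-words vanish. *)
Inductive Fspan (d : nat) : M -> Prop :=
| Fspan0 : Fspan d 0
| Fspan_cons c w x : (size w < d)%N -> Fspan d x -> Fspan d (c *: Fword w + x).

Lemma Fspan_lin d c x y : Fspan d x -> Fspan d y -> Fspan d (c *: x + y).
Proof.
move=> Hx Hy; elim: Hx => [|b w z ltw _ IH]; first by rewrite scaler0 add0r.
by rewrite scalerDr scalerA -addrA; apply: Fspan_cons.
Qed.

Lemma FspanZ d c x : Fspan d x -> Fspan d (c *: x).
Proof. by move=> Hx; rewrite -[_ *: _]addr0; apply: Fspan_lin => //; apply: Fspan0. Qed.

Lemma FspanD d x y : Fspan d x -> Fspan d y -> Fspan d (x + y).
Proof. by move=> Hx Hy; rewrite -[x]scale1r; apply: Fspan_lin. Qed.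

Lemma Fspan_word d w : (size w < d)%N -> Fspan d (Fword w).
Proof.
by move=> ltw; rewrite -[Fword w]scale1r -[_ *: _]addr0; apply/Fspan_cons/Fspan0.
Qed.

Lemma Fspan_le d e x : (d <= e)%N -> Fspan d x -> Fspan e x.
Proof.
move=> de; elim=> [|c w y ltw _ IH]; first exact: Fspan0.
by apply: Fspan_cons => //; apply: leq_trans de.
Qed.

Lemma Fspan_zero x : Fspan 0 x -> x = 0.
Proof. by case. Qed.

Lemma Fspan_ind_lin d e (f : M -> M) :
  (forall c x y, f (c *: x + y) = c *: f x + f y) ->
  (forall w, (size w < d)%N -> Fspan e (f (Fword w))) ->
  forall x, Fspan d x -> Fspan e (f x).
Proof.
move=> f_lin Hf x; elim=> [|c w y ltw _ IH].
  by rewrite (lin0 f_lin); apply: Fspan0.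
by rewrite f_lin; apply: Fspan_lin => //; apply: Hf.
Qed.

Lemma FspanF d i x : Fspan d x -> Fspan d.+1 (uF a i x).
Proof.
apply: Fspan_ind_lin; first exact: uF_lin.
by move=> w ltw; apply: (Fspan_word (w := i :: w)).
Qed.

Lemma FspanK d i x : Fspan d x -> Fspan d (uK a i x).
Proof.
apply: Fspan_ind_lin; first exact: uK_lin.
by move=> w ltw; rewrite Fword_wspace; apply/FspanZ/Fspan_word.
Qed.

Lemma FspanKi d i x : Fspan d x -> Fspan d (uKi a i x).
Proof.
apply: Fspan_ind_lin; first exact: uKi_lin.
by move=> w ltw; rewrite (wspaceKi _ (Fword_wspace w)); apply/FspanZ/Fspan_word.
Qed.

Lemma FspanE d i x : Fspan d.+1 x -> Fspan d (uE a i x).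
Proof.
apply: Fspan_ind_lin; first exact: uE_lin.
move=> w; elim: w d => [|j w IH] d ltw; first by rewrite /= Em; apply: Fspan0.
rewrite /= (uEF_wspace _ _ (Fword_wspace w)).
case: d ltw => [//|d] ltw; apply: FspanD.
  by apply: FspanF; apply: IH.
by apply/FspanZ/Fspan_word.
Qed.

Lemma FspanE_word d w x : Fspan d x -> (d <= size w)%N ->
  foldr (fun i y => uE a i y) x w = 0.
Proof.
move=> Hx dw; apply: Fspan_zero.
have {dw} : (d - size w)%N = 0%N by lia.
move <-; elim: w => [|i w IH]; first by rewrite subn0.
apply: FspanE; apply: Fspan_le IH; rewrite /=; lia.
Qed.

Lemma Fspan_submodule : submodule a (fun x => exists d, Fspan d x).
Proof.
split; first by exists 0%N; apply: Fspan0.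
split.
  move=> x y [d Hx] [e Hy]; exists (maxn d e); apply: FspanD.
    by apply: Fspan_le Hx; apply: leq_maxl.
  by apply: Fspan_le Hy; apply: leq_maxr.
split; first by move=> c x [d Hx]; exists d; apply: FspanZ.
move=> i x [d Hx]; split; last split; last split.
- by exists d; apply: FspanE; apply: Fspan_le Hx.
- by exists d.+1; apply: FspanF.
- by exists d; apply: FspanK.
- by exists d; apply: FspanKi.
Qed.

Lemma Fspan_list d x : Fspan d x ->
  exists s : seq (Qv * seq int), x = \sum_(p <- s) p.1 *: Fword p.2.
Proof.
elim=> [|c w y _ _ [s ->]]; first by exists [::]; rewrite big_nil.
by exists ((c, w) :: s); rewrite big_cons.
Qed.

Definition Fterms (s : seq (Qv * seq int)) : seq (weight * M) :=
  [seq (lower la p.2, p.1 *: Fword p.2) | p <- s].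

Lemma Fterms_wvecs s : wvecs a (Fterms s).
Proof.
elim: s => [|p s IH] q //= [<-|/IH //] /=.
by apply: wspaceZ; apply: Fword_wspace.
Qed.

(** This serves both directions of dominance: the coefficient vanishes at
    $n=\lambda_i-\lambda_{i+1}$, and only there. *)
Lemma sl2_hw i (n : nat) :
  uE a i (iter n.+1 (uF a i) m) =
  (qnum n.+1 * qnum (la i - la (i + 1) - n%:Z)) *: iter n (uF a i) m.
Proof.
have Wn k : in_wspace a (lower la (nseq k i)) (iter k (uF a i) m).
  have -> : iter k (uF a i) m = Fword (nseq k i) by elim: k => //= k ->.
  exact: Fword_wspace.
have wt k : lower la (nseq k i) i - lower la (nseq k i) (i + 1) =
    la i - la (i + 1) - k%:Z - k%:Z.
  rewrite /lower !big_nseq !GRing.iter_addr_0 /alpha eqxx.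
  rewrite (_ : i == i + 1 = false); last by lia.
  rewrite (_ : i + 1 == i = false); last by lia.
  by rewrite eqxx subr0 sub0r -!mulNrn; lia.
have q1 : qnum 1 = 1.
  have H : v - v^-1 != 0.
    by move: (qnum_eq0 1); rewrite /qnum expr1z exprN1; apply: contraFneq => ->;
      rewrite mulr0.
  by rewrite /qnum expr1z exprN1 mulVf.
elim: n => [|n IH].
  by rewrite /= (uEF_wspace _ _ Wm) Em (lin0 (@uF_lin _ a i)) add0r eqxx q1 subr0.
rewrite [iter n.+2 _ _]iterS (uEF_wspace _ _ (Wn n.+1)) IH (linZ (@uF_lin _ a i)).
rewrite -iterS -scalerDl; congr (_ *: _); rewrite eqxx mul1r wt.
have -> : la i - la (i + 1) - n%:Z = la i - la (i + 1) - n.+1%:Z + 1 by lia.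
by rewrite qnum_rec; congr (qnum _ * _); lia.
Qed.

Hypothesis m_generates : forall P, submodule a P -> P m -> forall x, P x.

Lemma hw_Fspan x : exists d, Fspan d x.
Proof.
apply: (m_generates Fspan_submodule).
by exists 1%N; apply: (@Fspan_word 1 [::]).
Qed.

Lemma hw_terms x : exists s, x = \sum_(p <- Fterms s) p.2.
Proof.
have [d /Fspan_list [s ->]] := hw_Fspan x.
by exists s; rewrite /Fterms big_map.
Qed.

Lemma hw_weight_module : weight_module a.
Proof.
move=> x; have [s ->] := hw_terms x.
by exists (Fterms s); split=> //; apply: Fterms_wvecs.
Qed.

Lemma hw_Chi : in_Chi a.
Proof.
split=> [|x]; first exact: hw_weight_module.
by have [d Hd] := hw_Fspan x; exists d => w; apply: FspanE_word.
Qed.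

Lemma hw_component mu x : in_wspace a mu x ->
  exists2 s, (forall p, p \in s -> lower la p.2 = mu) &
    x = \sum_(p <- s) p.1 *: Fword p.2.
Proof.
have [s ->] := hw_terms x => /(wspace_component (@Fterms_wvecs s)) ->.
exists [seq p <- s | `[< lower la p.2 = mu >]].
  by move=> p; rewrite mem_filter => /andP [/asboolP].
by rewrite /Fterms big_map big_filter.
Qed.

Lemma hw_is_weight mu : is_weight a mu -> le_wt mu la.
Proof.
move=> [x xn0 /hw_component [[|p s] Hs ex]].
  by rewrite ex big_nil eqxx in xn0.
by apply/le_wtP; exists p.2; rewrite (Hs p) ?mem_head.
Qed.

(** Words of equal weight are permutations of one another, so the F-words on the permutations of a
    single [s0] span the weight space. *)
Lemma hw_fin_dim mu : fin_dim_wspace a mu.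
Proof.
have [[s0 Hs0]|no] := pselect (exists s0, mu = lower la s0); last first.
  exists [::]; split=> // x /hw_component [s Hs ex].
  exists (fun _ => 0); rewrite big_ord0 ex.
  case: s Hs {ex} => [|p s] Hs; first by rewrite big_nil.
  by case: no; exists p.2; rewrite (Hs p) ?mem_head.
pose B := [seq Fword w | w <- permutations s0].
exists B; split.
  move=> y /mapP [w]; rewrite mem_permutations => pw ->.
  rewrite Hs0 (_ : lower la s0 = lower la w); first exact: Fword_wspace.
  by apply/funext => j; rewrite /lower (perm_big _ pw).
move=> x /hw_component [s Hs ->] {x}.
elim: s Hs => [|p s IH] Hs.
  exists (fun _ => 0); rewrite big_nil big1 // => k _; exact: scale0r.
have [c ec] : exists c : 'I_(size B) -> Qv,
    \sum_(p <- s) p.1 *: Fword p.2 = \sum_(k < size B) c k *: B`_k.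
  by apply: IH => q qs; apply: Hs; rewrite inE qs orbT.
have pB : Fword p.2 \in B.
  apply: map_f; rewrite mem_permutations; apply: (@lower_perm la).
  by rewrite (Hs p) ?mem_head.
have ltB : (index (Fword p.2) B < size B)%N by rewrite index_mem.
(* The new coefficient goes to the first occurrence of the vector in [B], which may have
   repetitions. *)
exists (fun k => (k == Ordinal ltB)%:R * p.1 + c k).
rewrite big_cons ec [RHS](eq_bigr (fun k : 'I_(size B) =>
  ((k == Ordinal ltB)%:R * p.1) *: B`_k + c k *: B`_k)); last first.
  by move=> k _; rewrite scalerDl.
rewrite big_split /=; congr (_ + _); rewrite (bigD1 (Ordinal ltB)) //= eqxx mul1r.
rewrite nth_index // big1 ?addr0 // => k /negbTE ->.
by rewrite mul0r scale0r.
Qed.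

Lemma hw_O : in_O a.
Proof.
split; first exact: hw_weight_module.
split; first exact: hw_fin_dim.
exists [:: la] => mu /hw_is_weight le_mu; exists la => //; by left.
Qed.

Hypothesis m_F_nilpotent : forall i, exists n, iter n (uF a i) m = 0.

Lemma iter_uF_lin i n c x y :
  iter n (uF a i) (c *: x + y) = c *: iter n (uF a i) x + iter n (uF a i) y.
Proof. by elim: n => //= n ->; rewrite uF_lin. Qed.

(* By the Serre relation F_i^(n+1) F_j lies in the left ideal of F_i^n. *)
Lemma serre_iter i j n x : `|i - j| = 1 -> exists c d : Qv,
  iter n.+1 (uF a i) (uF a j x) =
  c *: uF a i (uF a j (iter n (uF a i) x)) + d *: uF a j (iter n.+1 (uF a i) x).
Proof.
move=> ij; elim: n => [|n [c [d IH]]].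
  by exists 1, 0; rewrite /= scale1r scale0r addr0.
(* One more $F_i$ yields $cF_i^2F_jy+dF_iF_jF_iy$, and Serre replaces $F_i^2F_jy$ by
   $(v+v^{-1})F_iF_jF_iy-F_jF_i^2y$. *)
exists (c * (v + v^-1) + d), (- c).
rewrite iterS IH (linD (@uF_lin _ a i)) !(linZ (@uF_lin _ a i)).
set y := iter n (uF a i) x.
have /eqP := uSerreF a y ij; rewrite addr_eq0 subr_eq => /eqP ->.
rewrite scalerDr scalerN scalerA scaleNr scalerDl /= -/y.
by rewrite -addrA addrC addrAC.
Qed.

Definition F_nilpotent i x := exists n0, forall n, (n0 <= n)%N -> iter n (uF a i) x = 0.

Lemma F_nilpotentP i n x : iter n (uF a i) x = 0 -> F_nilpotent i x.
Proof.
move=> H; exists n => k nk; rewrite -(subnK nk) iterD H.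
by elim: (k - n)%N => //= h ->; rewrite (lin0 (@uF_lin _ a i)).
Qed.

Lemma F_nilpotentF i j x : F_nilpotent i x -> F_nilpotent i (uF a j x).
Proof.
move=> [n Hn]; have [<-|ij] := eqVneq i j.
  by exists n => k nk; rewrite -iterSr Hn // ltnW.
have [ij1|far] : `|i - j| = 1 \/ 1 < `|i - j| by lia.
  apply: (@F_nilpotentP i n.+1); have [c [d ->]] := serre_iter n x ij1.
  by rewrite !Hn // !(lin0 (@uF_lin _ a _)) !scaler0 addr0.
exists n => k nk.
have -> : iter k (uF a i) (uF a j x) = uF a j (iter k (uF a i) x).
  by elim: k {nk} => //= k ->; rewrite uFF.
by rewrite Hn // (lin0 (@uF_lin _ a _)).
Qed.

Lemma hw_Cint : in_Cint a.
Proof.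
split=> [|x i]; first exact: hw_weight_module.
have [nF HF] : F_nilpotent i x.
  have [d] := hw_Fspan x; elim=> [|c w y _ _ [n1 H1]].
    by apply: (@F_nilpotentP i 0).
  have [n2 H2] : F_nilpotent i (Fword w).
    elim: w => [|j w IH]; last exact: F_nilpotentF.
    by have [n] := m_F_nilpotent i; apply: F_nilpotentP.
  exists (maxn n1 n2) => n; rewrite geq_max => /andP [n1n n2n].
  by rewrite iter_uF_lin H1 // H2 // scaler0 addr0.
have [_ /(_ x) [nE HE]] := hw_Chi.
exists (maxn nE nF) => n; rewrite geq_max => /andP [nEn nFn]; split; last exact: HF.
by have := HE (nseq n i); rewrite size_nseq => <- //; elim: n {nEn nFn} => //= n ->.
Qed.

End HighestWeight.

(** * Dominance and existence of highest weight vectors *)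

Lemma hw_dominant (M : lmodType Qv) (a : Uaction M) la m :
  in_wspace a la m -> (forall i, uE a i m = 0) -> m != 0 ->
  (forall i, exists n, iter n (uF a i) m = 0) -> dominant la.
Proof.
move=> Wm Em m0 Hn i; have ex : exists n, iter n (uF a i) m == 0.
  by have [n e] := Hn i; exists n; apply/eqP.
(* With $n+1$ the least exponent killing [m], applying $E_i$ gives
   $[n+1][\lambda_i-\lambda_{i+1}-n]F_i^nm=0$ with $F_i^nm\ne0$, so $\lambda_i-\lambda_{i+1}=n$. *)
case: (ex_minnP ex) => -[|n] /eqP e min.
  by rewrite -[m]/(iter 0 (uF a i) m) e eqxx in m0.
have := sl2_hw Wm Em i n; rewrite e (lin0 (@uE_lin _ a i)) => /esym/eqP.
rewrite scaler_eq0 mulf_eq0 !qnum_eq0 => /orP [/orP [//|H]|/min]; last by rewrite ltnn.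
by rewrite -subr_ge0; move: H; rewrite subr_eq0 => /eqP ->.
Qed.

(** A longest E-word not killing [x] does it; the bound [n] is lowered until it is met. *)
Lemma singular_vector (M : lmodType Qv) (a : Uaction M) n (x : M) :
  (forall w, (n <= size w)%N -> foldr (fun i y => uE a i y) x w = 0) -> x != 0 ->
  exists w (y := foldr (fun i y => uE a i y) x w), y != 0 /\ forall i, uE a i y = 0.
Proof.
elim: n => [|n IH] Hx x0; first by have /= e := Hx [::] isT; rewrite e eqxx in x0.
have [[w [sw nz]]|no] := pselect (exists w : seq int, size w = n /\
    foldr (fun i y => uE a i y) x w != 0).
  by exists w; split=> // i; apply: (Hx (i :: w)); rewrite /= sw.
apply: IH => // w; rewrite leq_eqVlt => /orP [/eqP e|]; last exact: Hx.
by apply: contrapT => /eqP nz; apply: no; exists w.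
Qed.

Lemma raise_wspace (M : lmodType Qv) (a : Uaction M) mu x w : in_wspace a mu x ->
  exists2 nu, in_wspace a nu (foldr (fun i y => uE a i y) x w) & mu = lower nu w.
Proof.
move=> Wx; elim: w => [|i w [nu Wn e]]; first by exists mu; rewrite // lower_nil.
exists (fun j => nu j + alpha i j); first exact: wspaceE.
by rewrite e; apply/funext => j; rewrite lower_cons /lower; ring.
Qed.

Lemma nonzero_weight_vector (M : lmodType Qv) (a : Uaction M) (x : M) :
  weight_module a -> x != 0 -> exists mu y, in_wspace a mu y /\ y != 0.
Proof.
move=> /(_ x) [s [Hs ->]] nz; apply: contrapT => no; case/eqP: nz.
elim: s Hs => [|p s IH] Hs; first by rewrite big_nil.
rewrite big_cons IH => [|q qs]; last by apply: Hs; right.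
rewrite addr0; apply: contrapT => /eqP p0; apply: no; exists p.1, p.2.
by split=> //; apply: Hs; left.
Qed.

Lemma O_bounded (M : lmodType Qv) (a : Uaction M) mu x : in_O a -> in_wspace a mu x ->
  exists n : nat, forall w, (n <= size w)%N -> foldr (fun i y => uE a i y) x w = 0.
Proof.
move=> [_ [_ [ls Hls]]] Wx.
(* [n] exceeds the length of every descent from a weight of [ls] to [mu]. For each such weight this
   length is unique, by [lower_perm]. *)
have [n Hn] : exists n : nat, forall la, inL la ls ->
    forall t, mu = lower la t -> (size t < n)%N.
  elim: ls {Hls} => [|la ls [n IH]]; first by exists 0%N.
  have [[t0 e0]|no] := pselect (exists t, mu = lower la t).
    exists (maxn n (size t0).+1) => nu [<- t e|nus t e]; rewrite leq_max.
      rewrite orbC; apply/orP; left; rewrite ltnS.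
      by rewrite (perm_size (@lower_perm la t t0 _)) // -e.
    by rewrite (IH _ nus _ e).
  by exists n => nu [<- t e|]; [case: no; exists t | exact: IH].
exists n => w nw; apply: contrapT => /eqP nz.
have [nu Wn e] := raise_wspace w Wx.
have [la lals /le_wtP [s es]] : exists2 la, inL la ls & le_wt nu la.
  by apply: Hls; exists (foldr (fun i y => uE a i y) x w).
(* The descent from [la] to [mu] passes through [nu], so [w] is shorter than [n]. *)
have := Hn la lals (s ++ w) _; rewrite size_cat => H.
have : (size s + size w < n)%N.
  apply: H; rewrite e es; apply/funext => j; rewrite /lower big_cat /=; ring.
by move: nw; lia.
Qed.

Lemma exists_hw (M : lmodType Qv) (a : Uaction M) (x : M) :
  weight_module a -> in_Chi a \/ in_O a -> x != 0 ->
  exists la m, [/\ in_wspace a la m, m != 0 & forall i, uE a i m = 0].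
Proof.
move=> WM C x0; have [mu [y [Wy y0]]] := nonzero_weight_vector WM x0.
have [n Hn] : exists n : nat, forall w, (n <= size w)%N ->
    foldr (fun i y => uE a i y) y w = 0.
  by case: C => [[_ /(_ y)] //|/O_bounded]; apply; apply: Wy.
have [w [z0 Ez]] := singular_vector Hn y0.
by have [nu Wn _] := raise_wspace w Wy; exists nu, (foldr (fun i y => uE a i y) y w).
Qed.

(** * Verma modules and their irreducible quotients *)

Section Verma.
Variable la : weight.

(** The index set for the Verma module: it is generated by the family of all such vectors in the
    product of all such modules, so its universal maps are coordinate projections. *)
Record hw_module := HwModule {
  hwM : lmodType Qv; hwa : Uaction hwM; hwv : hwM;
  hwK : in_wspace hwa la hwv; hwE : forall i, uE hwa i hwv = 0 }.

Let N (k : hw_module) := hwM k.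
Let a (k : hw_module) : preaction v (N k) := preaction_of (hwa k).

Definition verma : lmodType Qv := cyc a hwv.

Fact verma_EE (k : hw_module) i j t : 1 < `|i - j| ->
  pE (a k) i (pE (a k) j (eval (a k) (hwv k) t)) =
  pE (a k) j (pE (a k) i (eval (a k) (hwv k) t)).
Proof. exact: uEE. Qed.

Fact verma_FF (k : hw_module) i j t : 1 < `|i - j| ->
  pF (a k) i (pF (a k) j (eval (a k) (hwv k) t)) =
  pF (a k) j (pF (a k) i (eval (a k) (hwv k) t)).
Proof. exact: uFF. Qed.

Fact verma_serreE (k : hw_module) i j t (e := pE (a k)) (x := eval (a k) (hwv k) t) :
  `|i - j| = 1 ->
  e i (e i (e j x)) - (v + v^-1) *: e i (e j (e i x)) + e j (e i (e i x)) = 0.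
Proof. exact: uSerreE. Qed.

Fact verma_serreF (k : hw_module) i j t (e := pF (a k)) (x := eval (a k) (hwv k) t) :
  `|i - j| = 1 ->
  e i (e i (e j x)) - (v + v^-1) *: e i (e j (e i x)) + e j (e i (e i x)) = 0.
Proof. exact: uSerreF. Qed.

Definition verma_action : Uaction verma :=
  cyc_action verma_EE verma_FF verma_serreE verma_serreF.

Definition verma_gen : verma := cgen a hwv.

Lemma hom_eq_submodule (V M : lmodType Qv) (b : Uaction V) (c : Uaction M)
    (f g : V -> M) :
  is_hom b c f -> is_hom b c g -> submodule b (fun x => f x = g x).
Proof.
move=> [fl fa] [gl ga]; split; first by rewrite (lin0 fl) (lin0 gl).
split; first by move=> x y ex ey; rewrite (linD fl) (linD gl) ex ey.
split; first by move=> d x ex; rewrite (linZ fl) (linZ gl) ex.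
move=> i x ex; have [-> [-> [-> ->]]] := fa i x; have [-> [-> [-> ->]]] := ga i x.
by rewrite ex.
Qed.

Lemma verma_is_verma : is_verma verma_action la verma_gen.
Proof.
split; first by move=> i; apply: cev_inj => k;
  rewrite cev_act (linZ (@cev_lin _ _ _ _ k)) cev_gen /= hwK.
split; first by move=> i; apply: cev_inj => k;
  rewrite cev_act (lin0 (@cev_lin _ _ _ _ k)) cev_gen /= hwE.
move=> M c n Wn En; pose k := HwModule Wn En.
have fhom : is_hom verma_action c (@cev _ _ a hwv k).
  split; first by move=> d x y; exact: (@cev_lin _ _ a hwv k d x y).
  by move=> i x; rewrite /= !cev_act.
exists (@cev _ _ a hwv k); split=> //; first exact: (@cev_gen _ _ a hwv k).
move=> g ghom gn x; move: x; apply: (cyc_generated (hom_eq_submodule ghom fhom)).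
by rewrite gn (@cev_gen _ _ a hwv k).
Qed.

End Verma.

(** The universal map sends the Verma generator to $m\ne0$, so its image is everything. A submodule
    containing the kernel has image zero or everything, so the kernel is maximal. *)
Lemma irreducible_iso_L (M : lmodType Qv) (a : Uaction M) la m :
  irreducible a -> in_wspace a la m -> m != 0 -> (forall i, uE a i m = 0) -> iso_L a la.
Proof.
move=> [_ irr] Wm m0 Em.
exists (verma la), (verma_action la), (verma_gen la).
split; first exact: verma_is_verma.
have [_ [_ /(_ M a m Wm Em) [f [fhom fm _]]]] := verma_is_verma la.
have [fl fa] := fhom.
exists f; split=> //.
  have : submodule a (fun y => exists x, f x = y).
    split; first by exists 0; apply: lin0 fl.
    split; first by move=> _ _ [x <-] [y <-]; exists (x + y); apply: linD fl _ _.
    split; first by move=> c _ [x <-]; exists (c *: x); apply: linZ fl _ _.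
    by move=> i _ [x <-]; have [<- [<- [<- <-]]] := fa i x; do !split; eexists.
  move=> /irr [/(_ m) H|//]; case/eqP: m0; apply: H; by exists (verma_gen la).
split.
  split; first exact: lin0 fl.
  split; first by move=> x y ex ey; rewrite (linD fl) ex ey addr0.
  split; first by move=> c x ex; rewrite (linZ fl) ex scaler0.
  move=> i x ex; have [-> [-> [-> ->]]] := fa i x; rewrite ex.
  by rewrite (lin0 (@uE_lin _ a i)) (lin0 (@uF_lin _ a i))
    (lin0 (@uK_lin _ a i)) (lin0 (@uKi_lin _ a i)).
split; first by exists (verma_gen la); rewrite fm; apply/eqP.
move=> Q [Q0 [QD [QZ Qa]]] kerQ.
have : submodule a (fun y => exists2 x, Q x & f x = y).
  split; first by exists 0 => //; apply: lin0 fl.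
  split; first by move=> _ _ [x Qx <-] [y Qy <-];
    exists (x + y); [apply: QD|apply: linD fl _ _].
  split; first by move=> c _ [x Qx <-]; exists (c *: x); [apply: QZ|apply: linZ fl _ _].
  move=> i _ [x Qx <-]; have [<- [<- [<- <-]]] := fa i x.
  by have [? [? [? ?]]] := Qa i x Qx; do !split; eexists; try reflexivity.
move=> /irr [H|H]; [left=> x Qx; apply: H; by exists x|right=> x].
have [y Qy e] := H (f x).
rewrite -(subrK y x); apply: QD => //; apply: kerQ.
by rewrite (linB fl) e subrr.
Qed.

(** The generator is the image of the Verma generator. If it were zero, uniqueness would make $f=0$,
    against properness of the kernel. For generation, the preimage of [P] contains the kernel and
    maximality applies. *)
Lemma iso_L_generator (M : lmodType Qv) (a : Uaction M) la : iso_L a la ->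
  exists m, [/\ m != 0, in_wspace a la m, forall i, uE a i m = 0 &
    forall P, submodule a P -> P m -> forall x, P x].
Proof.
move=> [V [b [mV [[WmV [EmV univ]] [f [[fl fa] fsurj [_ [[x0 fx0] kmax]]]]]]]].
have zhom : is_hom b a (fun _ : V => 0 : M).
  split; first by move=> *; rewrite scaler0 addr0.
  move=> i x.
  by rewrite (lin0 (@uE_lin _ a i)) (lin0 (@uF_lin _ a i))
    (lin0 (@uK_lin _ a i)) (lin0 (@uKi_lin _ a i)).
have fm0 : f mV != 0.
  apply/eqP => fm; have [|i|g [_ _ gu]] := univ M a 0.
  - exact: wspace0.
  - exact: lin0 (@uE_lin _ a i).
  by apply: fx0; rewrite (gu f) // -(gu _ zhom).
exists (f mV); split=> //.
- by move=> i; have [_ [_ [<- _]]] := fa i mV; rewrite WmV (linZ fl).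
- by move=> i; have [<- _] := fa i mV; rewrite EmV (lin0 fl).
move=> P [P0 [PD [PZ Pa]]] Pm.
have Qsub : submodule b (fun x => P (f x)).
  split; first by rewrite (lin0 fl).
  split; first by move=> x y; rewrite (linD fl); apply: PD.
  split; first by move=> c x; rewrite (linZ fl); apply: PZ.
  move=> i x /(Pa i); by have [-> [-> [-> ->]]] := fa i x.
have [|/(_ mV Pm) e|H x] := kmax _ Qsub.
- by move=> x ->.
- by rewrite e eqxx in fm0.
by have [y <-] := fsurj x.
Qed.

Lemma iso_L_weight_unique (M : lmodType Qv) (a : Uaction M) la mu :
  iso_L a la -> iso_L a mu -> la = mu.
Proof.
move=> /iso_L_generator [m [m0 Wm Em Gm]] /iso_L_generator [n [n0 Wn En Gn]].
apply: le_wt_anti.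
  by apply: (hw_is_weight Wm Em Gm); exists n.
by apply: (hw_is_weight Wn En Gn); exists m.
Qed.

(** * The simple module of highest weight [la] *)

Section Simple.
Variable la : weight.
(** The cyclic construction with a single factor, hence the index type [unit]. *)
Let a (_ : unit) := dual_verma la v_neq0.
Let m (_ : unit) := dhw Qv : (seq int -> Qv^o).

Definition simple : lmodType Qv := cyc a m.

Lemma dual_verma_orbit R (b := chevalley (a tt) v_neq0) :
  (exists i j, (1 < `|i - j| /\ R = commF b i j) \/
     (`|i - j| = 1 /\ R = serreF b i j)) ->
  forall t, R (eval (a tt) (m tt) t) = 0.
Proof.
move=> HR t; have [PE PF PK PKi PL] := Ekilled_orbit HR.
have R_lin c x y : R (c *: x + y) = c *: R x + R y.
  by case: HR => i [j [] [_ ->]]; [apply: commF_lin | apply: serreF_lin].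
have P0 : Ekilled (a tt) R 0 by apply: Ekilled0.
suff : Ekilled (a tt) R (eval (a tt) (m tt) t) by move=> /(_ [::]).
apply: eval_closed => //; last first.
  by move=> [[[] []] i] x Px /=; [apply: PE|apply: PF|apply: PK|apply: PKi].
(* A nonempty E-word sends the indicator to 0. For the empty word, each term of [R] begins by
   applying some [pF b i], which is $E_i$. *)
move=> [|i w]; last exact: P0 w.
have E0 i : pF b i (m tt) = 0 by [].
case: HR => i [j [] [_ ->]] /=.
  by rewrite /commF !E0 !(lin0 (@pF_lin _ _ _ b _)) subr0.
by rewrite /serreF !E0 !(lin0 (@pF_lin _ _ _ b _)) scaler0 subr0 addr0.
Qed.

Fact simple_EE k i j t : 1 < `|i - j| ->
  pE (a k) i (pE (a k) j (eval (a k) (m k) t)) =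
  pE (a k) j (pE (a k) i (eval (a k) (m k) t)).
Proof.
case: k => ij; apply/eqP; rewrite -subr_eq0; apply/eqP.
apply: (@dual_verma_orbit (commF (chevalley (a tt) v_neq0) i j)).
by exists i, j; left.
Qed.

Fact simple_FF k i j t : 1 < `|i - j| ->
  pF (a k) i (pF (a k) j (eval (a k) (m k) t)) =
  pF (a k) j (pF (a k) i (eval (a k) (m k) t)).
Proof.
move=> ij; apply/eqP; rewrite -subr_eq0; apply/eqP.
exact: (dual_verma_commF la v_neq0 _ ij).
Qed.

Fact simple_serreE k i j t (e := pE (a k)) (x := eval (a k) (m k) t) : `|i - j| = 1 ->
  e i (e i (e j x)) - (v + v^-1) *: e i (e j (e i x)) + e j (e i (e i x)) = 0.
Proof.
rewrite {}/e {}/x; case: k => ij.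
apply: (@dual_verma_orbit (serreF (chevalley (a tt) v_neq0) i j)).
by exists i, j; right.
Qed.

Fact simple_serreF k i j t (e := pF (a k)) (x := eval (a k) (m k) t) : `|i - j| = 1 ->
  e i (e i (e j x)) - (v + v^-1) *: e i (e j (e i x)) + e j (e i (e i x)) = 0.
Proof. by move=> ij; exact: (dual_verma_serreF la v_neq0 _ ij). Qed.

Definition simple_action : Uaction simple :=
  cyc_action simple_EE simple_FF simple_serreE simple_serreF.

Definition simple_gen : simple := cgen a m.

Let iota : simple -> (seq int -> Qv^o) := @cev _ _ a m tt.

Let iota_lin c x y : iota (c *: x + y) = c *: iota x + iota y.
Proof. exact: (@cev_lin _ _ a m tt c x y). Qed.

Let iota_inj x y : iota x = iota y -> x = y.
Proof. by move=> e; apply: cev_inj => -[]. Qed.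

Let iota_gen : iota simple_gen = dhw Qv.
Proof. exact: (@cev_gen _ _ a m tt). Qed.

Let iota_act g x : iota (cact g x) = gact (a tt) g (iota x).
Proof. exact: (@cev_act _ _ a m tt). Qed.

Lemma simple_gen_wspace : in_wspace simple_action la simple_gen.
Proof.
move=> i; apply: iota_inj; rewrite (linZ iota_lin) iota_gen -dhw_K.
by rewrite [LHS](iota_act (false, true, i)) /= iota_gen.
Qed.

Lemma simple_gen_E i : uE simple_action i simple_gen = 0.
Proof.
apply: iota_inj; rewrite (lin0 iota_lin).
by rewrite [LHS](iota_act (true, true, i)) /= iota_gen.
Qed.

Lemma simple_gen_neq0 : simple_gen != 0.
Proof.
apply/eqP => /(congr1 iota); rewrite iota_gen (lin0 iota_lin).
by move=> /(congr1 (fun f => f [::])) /eqP; rewrite oner_eq0.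
Qed.

Lemma simple_generated (P : simple -> Prop) :
  submodule simple_action P -> P simple_gen -> forall x, P x.
Proof. exact: cyc_generated. Qed.

Lemma simple_singular x : (forall i, uE simple_action i x = 0) ->
  x = iota x [::] *: simple_gen.
Proof.
move=> Ex; apply: iota_inj; rewrite (linZ iota_lin) iota_gen.
apply: dual_verma_singular => i.
by rewrite -(lin0 iota_lin) -(Ex i) [RHS](iota_act (true, true, i)).
Qed.

Lemma simple_irreducible : irreducible simple_action.
Proof.
split; first by exists simple_gen; apply: simple_gen_neq0.
move=> P subP; have [all0|] := pselect (forall x, P x -> x = 0); first by left.
move=> /existsNP [x /not_implyP [Px /eqP x0]]; right.
have [_ /(_ x) [n Hn]] := hw_Chi simple_gen_wspace simple_gen_E simple_generated.
have [w [/= y0 /simple_singular]] := singular_vector Hn x0.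
set y := foldr _ _ _ in y0 *; have Py : P y.
  have [_ [_ [_ Pa]]] := subP.
  by rewrite /y; elim: (w) => //= i u IH; have [] := Pa i _ IH.
set c := iota y [::] => ey.
have c0 : c != 0 by apply: contraNneq y0 => c0; rewrite ey c0 scale0r.
apply: (simple_generated subP).
have [_ [_ [PZ _]]] := subP.
by rewrite -[simple_gen]scale1r -(mulVf c0) -scalerA -ey; apply: PZ.
Qed.

Lemma simple_F_nilpotent : dominant la ->
  forall i, exists n, iter n (uF simple_action i) simple_gen = 0.
Proof.
move=> dom i; have /gez0_abs en : 0 <= la i - la (i + 1) by rewrite subr_ge0.
set n := absz (la i - la (i + 1))%R in en; exists n.+1.
(* A vector killed by the E's is its value at the empty word times the generator, and that value is
   0 for anything in the image of an F. It remains to apply each $E_j$: for $j=i$ the coefficient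
   contains $[0]$, and otherwise $E_j$ commutes with $F_i$. *)
rewrite [LHS]simple_singular.
  rewrite (_ : iota _ [::] = 0) ?scale0r //.
  by rewrite iterS (iota_act (true, false, i)).
move=> j; have [<-|ij] := eqVneq i j.
  rewrite (sl2_hw simple_gen_wspace simple_gen_E) en subrr.
  by rewrite (eqP (_ : qnum 0 == 0)) ?mulr0 ?scale0r // qnum_eq0.
elim: (n.+1) => [|k IH]; first exact: simple_gen_E.
have := uEF simple_action j i (iter k (uF simple_action i) simple_gen).
rewrite eq_sym (negbTE ij) scale0r => /eqP; rewrite subr_eq0 => /eqP.
by rewrite iterS => ->; rewrite IH (lin0 (@uF_lin _ simple_action i)).
Qed.

End Simple.

(** This isolates what the two classifications share: [C] must contain the simple modules of
    dominant weight and bound the E-words on weight vectors in one of the two ways. *)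
Lemma L_bijection_of (C : forall M : lmodType Qv, Uaction M -> Prop) :
  (forall la, dominant la -> C (simple la) (simple_action la)) ->
  (forall (M : lmodType Qv) (a : Uaction M), C M a ->
     in_Cint a /\ (in_Chi a \/ in_O a)) ->
  L_bijection C.
Proof.
move=> Csimple Cle; split=> [la dom|].
  exists (simple la), (simple_action la); split; first exact: Csimple.
    exact: simple_irreducible.
  exact: irreducible_iso_L (simple_irreducible la) (@simple_gen_wspace la)
    (simple_gen_neq0 la) (@simple_gen_E la).
split=> [la mu M a _ _|M a /Cle [[WM nil] Ca] irr]; first exact: iso_L_weight_unique.
have [[x x0] _] := irr.
have [la [m [Wm m0 Em]]] := exists_hw WM Ca x0.
exists la; split; last exact: irreducible_iso_L irr Wm m0 Em.
apply: (hw_dominant Wm Em m0) => i.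
by have [n Hn] := nil m i; exists n; have [] := Hn n (leqnn n).
Qed.

Theorem theorem9p6 :
  L_bijection (fun M a => in_Cint a /\ in_Chi a) /\
  L_bijection (fun M a => in_Cint a /\ in_O a).
Proof.
by split; apply: L_bijection_of => [la dom|M a []]; try (by split; [|left]);
  try (by split; [|right]); split;
  (apply: hw_Cint || apply: hw_Chi || apply: hw_O);
  solve [exact: simple_gen_wspace | exact: simple_gen_E |
         exact: simple_generated | exact: simple_F_nilpotent].
Qed.
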